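(* For any distributive monoidal category $\mathcal{V}$, the double category $\mathcal{V}\text{-}\mathbb{M}\mathsf{at}$ of $\mathcal{V}$-matrices has strong coproducts.
   Context: A distributive monoidal category is a symmetric monoidal category with arbitrary (small) coproducts over which the tensor distributes separately in each variable. The double category $\mathcal{V}\text{-}\mathbb{M}\mathsf{at}$ has sets as objects, functions as arrows, and as proarrows $M\colon X\nrightarrow Y$ the $\mathcal{V}$-matrices, i.e. families of objects $M(x,y)\in\mathcal{V}$ for $(x,y)\in X\times Y$; a cell from $M\colon X\nrightarrow Y$ to $N\colon W\nrightarrow Z$ over functions $(f,g)$ is a family of morphisms $M(x,y)\to N(f(x),g(y))$ in $\mathcal{V}$; external composition is matrix multiplication $(M\odot N)(x,z)=\sum_{y\in Y}M(x,y)\otimes N(y,z)$, and the external identity has the monoidal unit on the diagonal and the initial object off the diagonal. Double categories and double functors are pseudo unless otherwise stated. A proarrow is written $m\colon x\nrightarrow y$; a cell $\alpha\colon m\to n$ over $(f,g)$ has left side $f$ and right side $g$. For a span of sets $I\xleftarrow{\ell}A\xrightarrow{r}J$, written $A\colon I\nrightarrow J$, the notation $a\colon i\nrightarrow j$ means $a\in A$, $\ell(a)=i$, $r(a)=j$. The double category of families $\mathbb{F}\mathsf{am}(\mathbb{D})$ in a double category $\mathbb{D}$ has: - objects $(I,\underline{x})$: a set $I$ and objects $x_i$ of $\mathbb{D}$, $i\in I$; - arrows $(f_0,f)\colon(I,\underline{x})\to(J,\underline{y})$: a function $f_0\colon I\to J$ and arrows $f_i\colon x_i\to y_{f_0(i)}$;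 - proarrows $(A,\underline{m})\colon(I,\underline{x})\nrightarrow(J,\underline{y})$: a span of sets $A\colon I\nrightarrow J$ and proarrows $m_a\colon x_i\nrightarrow y_j$ for each $a\colon i\nrightarrow j$; - cells $(A,\underline{m})\to(B,\underline{n})$ over $((f_0,f),(g_0,g))$: a map of spans $(f_0,\alpha_0,g_0)$ and cells $\alpha_a\colon m_a\to n_{\alpha_0(a)}$ over $(f_i,g_j)$ for each $a\colon i\nrightarrow j$. External composition is by pullback of indexing spans and $(\underline{m}\odot\underline{n})_{(a,b)}=m_a\odot n_b$. $\Delta\colon\mathbb{D}\to\mathbb{F}\mathsf{am}(\mathbb{D})$ sends objects and proarrows to singleton families (indexed by $1$ and $1\leftarrow1\to1$). $\mathbb{D}$ has colax coproducts if $\Delta$ has a left adjoint $\Sigma\colon\mathbb{F}\mathsf{am}(\mathbb{D})\to\mathbb{D}$ in the 2-category of double categories, colax double functors, and natural transformations; it has strong coproducts if moreover $\Sigma$ is a pseudo double functor. *)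

(* Defs.v *)
From Stdlib Require Import ssreflect.
From Stdlib Require Import FunctionalExtensionality ProofIrrelevance
  ClassicalEpsilon.

Set Implicit Arguments.
Unset Strict Implicit.
Unset Printing Implicit Defensive.
Set Primitive Projections.

(** A single universe of small sets, for the index sets of families and of
    coproducts and for the objects of the double category of matrices.  The
    objects of a [category] live in a larger universe. *)
Definition small := Type.

(** Composition is written in diagrammatic order throughout. *)

Record category := Category {
  ob :> Type;
  hom : ob -> ob -> Type;
  idm : forall x, hom x x;
  cmp : forall x y z, hom x y -> hom y z -> hom x z;
  cmp_idl : forall x y (f : hom x y), cmp (idm x) f = f;
  cmp_idr : forall x y (f : hom x y), cmp f (idm y) = f;
  cmpA : forall x y z w (f : hom x y) (g : hom y z) (h : hom z w),
    cmp f (cmp g h) = cmp (cmp f g) h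
}.

Arguments hom {c} x y.
Arguments idm {c} x.
Arguments cmp {c x y z} f g.

Infix ">>>" := cmp (at level 50, left associativity).

Definition inverse_homs (C : category) (x y : C) (f : hom x y) (g : hom y x) :=
  f >>> g = idm x /\ g >>> f = idm y.

Definition invertible (C : category) (x y : C) (f : hom x y) : Prop :=
  exists g : hom y x, inverse_homs f g.

(** A pseudo double category is a pseudo-category internal to categories: the
    category [dcat] of objects and arrows, and a category whose objects are the
    proarrows and whose morphisms are the cells, with strict source and target
    functors.  A cell [a] is "over (f, g)" when [lside a = f] and
    [rside a = g]; [cell m n] gathers the cells from [m] to [n] over all pairs
    (f, g).  External composition of cells [hcmp] is defined on the pairs of
    cells with a common side. *)

Record dbldata := DblData {
  dcat :> category;
  pro : dcat -> dcat -> Type;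
  cell : forall x y w z, pro x y -> pro w z -> Type;
  lside : forall x y w z (m : pro x y) (n : pro w z), cell m n -> hom x w;
  rside : forall x y w z (m : pro x y) (n : pro w z), cell m n -> hom y z;
  cid : forall x y (m : pro x y), cell m m;
  ccmp : forall x y w z u v (m : pro x y) (n : pro w z) (p : pro u v),
    cell m n -> cell n p -> cell m p;
  odot : forall x y z, pro x y -> pro y z -> pro x z;
  hcmp : forall x y z x' y' z' (m : pro x y) (n : pro y z)
    (m' : pro x' y') (n' : pro y' z') (a : cell m m') (b : cell n n'),
    rside a = lside b -> cell (odot m n) (odot m' n');
  punit : forall x, pro x x;
  cunit : forall x y, hom x y -> cell (punit x) (punit y);
  dassoc : forall x y z w (m : pro x y) (n : pro y z) (p : pro z w),
    cell (odot (odot m n) p) (odot m (odot n p));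
  dlunit : forall x y (m : pro x y), cell (odot (punit x) m) m;
  drunit : forall x y (m : pro x y), cell (odot m (punit y)) m
}.

Arguments pro {d} x y.
Arguments cell {d x y w z} m n.
Arguments lside {d x y w z m n} a : rename.
Arguments rside {d x y w z m n} a : rename.
Arguments cid {d x y} m.
Arguments ccmp {d x y w z u v m n p} a b : rename.
Arguments odot {d x y z} m n : rename.
Arguments hcmp {d x y z x' y' z' m n m' n'} a b e : rename.
Arguments punit {d} x.
Arguments cunit {d x y} f : rename.
Arguments dassoc {d x y z w} m n p.
Arguments dlunit {d x y} m.
Arguments drunit {d x y} m.

Infix "**" := ccmp (at level 50, left associativity).
Infix "⊙" := odot (at level 40, left associativity).

Definition globular (D : dbldata) (x y : D) (m n : pro x y) (a : cell m n) :=
  lside a = idm x /\ rside a = idm y.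

Definition cell_invertible (D : dbldata) (x y w z : D)
  (m : pro x y) (n : pro w z) (a : cell m n) : Prop :=
  exists b : cell n m, a ** b = cid m /\ b ** a = cid n.

(** The side conditions of [hcmp] are propositions; the laws below hold for all
    their proofs. *)
Record dbllaws (D : dbldata) : Prop := DblLaws {
  ccmp_idl : forall (x y w z : D) (m : pro x y) (n : pro w z) (a : cell m n),
    cid m ** a = a;
  ccmp_idr : forall (x y w z : D) (m : pro x y) (n : pro w z) (a : cell m n),
    a ** cid n = a;
  ccmpA : forall (x y w z u v s t : D) (m : pro x y) (n : pro w z)
    (p : pro u v) (q : pro s t) (a : cell m n) (b : cell n p) (c : cell p q),
    a ** (b ** c) = (a ** b) ** c;
  lside_id : forall (x y : D) (m : pro x y), lside (cid m) = idm x;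
  rside_id : forall (x y : D) (m : pro x y), rside (cid m) = idm y;
  lside_cmp : forall (x y w z u v : D) (m : pro x y) (n : pro w z) (p : pro u v)
    (a : cell m n) (b : cell n p), lside (a ** b) = lside a >>> lside b;
  rside_cmp : forall (x y w z u v : D) (m : pro x y) (n : pro w z) (p : pro u v)
    (a : cell m n) (b : cell n p), rside (a ** b) = rside a >>> rside b;
  lside_hcmp : forall (x y z x' y' z' : D) (m : pro x y) (n : pro y z)
    (m' : pro x' y') (n' : pro y' z') (a : cell m m') (b : cell n n') e,
    lside (hcmp a b e) = lside a;
  rside_hcmp : forall (x y z x' y' z' : D) (m : pro x y) (n : pro y z)
    (m' : pro x' y') (n' : pro y' z') (a : cell m m') (b : cell n n') e,
    rside (hcmp a b e) = rside b;
  hcmp_id : forall (x y z : D) (m : pro x y) (n : pro y z) e,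
    hcmp (cid m) (cid n) e = cid (m ⊙ n);
  hcmp_cmp : forall (x y z x' y' z' x'' y'' z'' : D)
    (m : pro x y) (n : pro y z) (m' : pro x' y') (n' : pro y' z')
    (m'' : pro x'' y'') (n'' : pro y'' z'')
    (a : cell m m') (b : cell n n') (a' : cell m' m'') (b' : cell n' n'')
    e e' e'',
    hcmp (a ** a') (b ** b') e'' = hcmp a b e ** hcmp a' b' e';
  lside_cunit : forall (x y : D) (f : hom x y), lside (cunit f) = f;
  rside_cunit : forall (x y : D) (f : hom x y), rside (cunit f) = f;
  cunit_id : forall x : D, cunit (idm x) = cid (punit x);
  cunit_cmp : forall (x y z : D) (f : hom x y) (g : hom y z),
    cunit (f >>> g) = cunit f ** cunit g;
  dassoc_glob : forall (x y z w : D) (m : pro x y) (n : pro y z) (p : pro z w),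
    globular (dassoc m n p);
  dassoc_inv : forall (x y z w : D) (m : pro x y) (n : pro y z) (p : pro z w),
    cell_invertible (dassoc m n p);
  dassoc_nat : forall (x y z w x' y' z' w' : D)
    (m : pro x y) (n : pro y z) (p : pro z w)
    (m' : pro x' y') (n' : pro y' z') (p' : pro z' w')
    (a : cell m m') (b : cell n n') (c : cell p p') e1 e2 e3 e4,
    hcmp (hcmp a b e1) c e2 ** dassoc m' n' p' =
    dassoc m n p ** hcmp a (hcmp b c e3) e4;
  dlunit_glob : forall (x y : D) (m : pro x y), globular (dlunit m);
  dlunit_inv : forall (x y : D) (m : pro x y), cell_invertible (dlunit m);
  dlunit_nat : forall (x y x' y' : D) (m : pro x y) (m' : pro x' y')
    (a : cell m m') e,
    hcmp (cunit (lside a)) a e ** dlunit m' = dlunit m ** a;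
  drunit_glob : forall (x y : D) (m : pro x y), globular (drunit m);
  drunit_inv : forall (x y : D) (m : pro x y), cell_invertible (drunit m);
  drunit_nat : forall (x y x' y' : D) (m : pro x y) (m' : pro x' y')
    (a : cell m m') e,
    hcmp a (cunit (rside a)) e ** drunit m' = drunit m ** a;
  dtriangle : forall (x y z : D) (m : pro x y) (n : pro y z) e e',
    dassoc m (punit y) n ** hcmp (cid m) (dlunit n) e =
    hcmp (drunit m) (cid n) e';
  dpentagon : forall (x y z w v : D) (m : pro x y) (n : pro y z) (p : pro z w)
    (q : pro w v) e e',
    hcmp (dassoc m n p) (cid q) e ** dassoc m (n ⊙ p) q
      ** hcmp (cid m) (dassoc n p q) e' =
    dassoc (m ⊙ n) p q ** dassoc m n (p ⊙ q)
}.

Record dblcat := DblCat { dbl_data :> dbldata; dbl_laws : dbllaws dbl_data }.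

Record colax_data (D E : dbldata) := ColaxData {
  cf_ob :> D -> E;
  cf_hom : forall x y : D, hom x y -> hom (cf_ob x) (cf_ob y);
  cf_pro : forall x y : D, pro x y -> pro (cf_ob x) (cf_ob y);
  cf_cell : forall (x y w z : D) (m : pro x y) (n : pro w z),
    cell m n -> cell (cf_pro m) (cf_pro n);
  cf_comp : forall (x y z : D) (m : pro x y) (n : pro y z),
    cell (cf_pro (m ⊙ n)) (cf_pro m ⊙ cf_pro n);
  cf_unit : forall x : D, cell (cf_pro (punit x)) (punit (cf_ob x))
}.

Arguments cf_hom {D E} F {x y} f : rename.
Arguments cf_pro {D E} F {x y} m : rename.
Arguments cf_cell {D E} F {x y w z m n} a : rename.
Arguments cf_comp {D E} F {x y z} m n : rename.
Arguments cf_unit {D E} F x : rename.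

Record colax_laws (D E : dbldata) (F : colax_data D E) : Prop := ColaxLaws {
  cf_hom_id : forall x : D, cf_hom F (idm x) = idm (F x);
  cf_hom_cmp : forall (x y z : D) (f : hom x y) (g : hom y z),
    cf_hom F (f >>> g) = cf_hom F f >>> cf_hom F g;
  cf_lside : forall (x y w z : D) (m : pro x y) (n : pro w z) (a : cell m n),
    lside (cf_cell F a) = cf_hom F (lside a);
  cf_rside : forall (x y w z : D) (m : pro x y) (n : pro w z) (a : cell m n),
    rside (cf_cell F a) = cf_hom F (rside a);
  cf_cell_id : forall (x y : D) (m : pro x y),
    cf_cell F (cid m) = cid (cf_pro F m);
  cf_cell_cmp : forall (x y w z u v : D)
    (m : pro x y) (n : pro w z) (p : pro u v) (a : cell m n) (b : cell n p),
    cf_cell F (a ** b) = cf_cell F a ** cf_cell F b;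
  cf_comp_glob : forall (x y z : D) (m : pro x y) (n : pro y z),
    globular (cf_comp F m n);
  cf_unit_glob : forall x : D, globular (cf_unit F x);
  cf_comp_nat : forall (x y z x' y' z' : D) (m : pro x y) (n : pro y z)
    (m' : pro x' y') (n' : pro y' z') (a : cell m m') (b : cell n n') e e',
    cf_cell F (hcmp a b e) ** cf_comp F m' n' =
    cf_comp F m n ** hcmp (cf_cell F a) (cf_cell F b) e';
  cf_unit_nat : forall (x y : D) (f : hom x y),
    cf_cell F (cunit f) ** cf_unit F y = cf_unit F x ** cunit (cf_hom F f);
  cf_assoc : forall (x y z w : D) (m : pro x y) (n : pro y z) (p : pro z w)
    e e',
    cf_cell F (dassoc m n p) ** cf_comp F m (n ⊙ p)
      ** hcmp (cid (cf_pro F m)) (cf_comp F n p) e =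
    cf_comp F (m ⊙ n) p ** hcmp (cf_comp F m n) (cid (cf_pro F p)) e'
      ** dassoc (cf_pro F m) (cf_pro F n) (cf_pro F p);
  cf_lunit : forall (x y : D) (m : pro x y) e,
    cf_comp F (punit x) m ** hcmp (cf_unit F x) (cid (cf_pro F m)) e
      ** dlunit (cf_pro F m) =
    cf_cell F (dlunit m);
  cf_runit : forall (x y : D) (m : pro x y) e,
    cf_comp F m (punit y) ** hcmp (cid (cf_pro F m)) (cf_unit F y) e
      ** drunit (cf_pro F m) =
    cf_cell F (drunit m)
}.

Record colax (D E : dblcat) :=
  Colax { cf_data :> colax_data D E; cf_laws : colax_laws cf_data }.

(** A pseudo double functor, seen as a colax one with invertible comparison
    cells. *)
Definition is_pseudo (D E : dblcat) (F : colax D E) : Prop :=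
  (forall (x y z : D) (m : pro x y) (n : pro y z),
    cell_invertible (cf_comp F m n)) /\
  (forall x : D, cell_invertible (cf_unit F x)).

Definition colax_id_data (D : dbldata) : colax_data D D :=
  @ColaxData D D (fun x => x) (fun x y f => f) (fun x y m => m)
    (fun x y w z m n a => a) (fun x y z m n => cid (m ⊙ n))
    (fun x => cid (punit x)).

Definition colax_cmp_data (D E G : dbldata) (F : colax_data D E)
    (H : colax_data E G) : colax_data D G :=
  @ColaxData D G (fun x => H (F x))
    (fun x y f => cf_hom H (cf_hom F f))
    (fun x y m => cf_pro H (cf_pro F m))
    (fun x y w z m n a => cf_cell H (cf_cell F a))
    (fun x y z m n => cf_cell H (cf_comp F m n)
                      ** cf_comp H (cf_pro F m) (cf_pro F n))
    (fun x => cf_cell H (cf_unit F x) ** cf_unit H (F x)).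

Lemma hcmp_irr (D : dbldata) (x y z x' y' z' : D) (m : pro x y) (n : pro y z)
    (m' : pro x' y') (n' : pro y' z') (a a' : cell m m') (b b' : cell n n')
    e e' : a = a' -> b = b' -> hcmp a b e = hcmp a' b' e'.
Proof.
move=> ea eb; move: e e'; rewrite ea eb => e e'.
by rewrite (proof_irrelevance _ e e').
Qed.

Lemma hcmp_cmp_eq (D : dblcat) (x y z x' y' z' x'' y'' z'' : D)
    (m : pro x y) (n : pro y z) (m' : pro x' y') (n' : pro y' z')
    (m'' : pro x'' y'') (n'' : pro y'' z'')
    (a : cell m m') (a' : cell m' m'') (b : cell n n') (b' : cell n' n'')
    (c : cell m m'') (d : cell n n'') e e1 e2 :
  a ** a' = c -> b ** b' = d -> hcmp c d e = hcmp a b e1 ** hcmp a' b' e2.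
Proof.
move=> E E'; have e0 : rside (a ** a') = lside (b ** b') by rewrite E E'.
by rewrite -(hcmp_cmp (dbl_laws D) e1 e2 e0); apply: hcmp_irr.
Qed.

Lemma colax_id_laws (D : dblcat) : colax_laws (colax_id_data D).
Proof.
have L := dbl_laws D.
split => //=.
- by move=> *; split; [exact: (lside_id L) | exact: (rside_id L)].
- by move=> *; split; [exact: (lside_id L) | exact: (rside_id L)].
- move=> *; rewrite (ccmp_idl L) (ccmp_idr L); exact: hcmp_irr.
- by move=> *; rewrite (ccmp_idl L) (ccmp_idr L).
- by move=> *; rewrite !(hcmp_id L) !(ccmp_idl L) !(ccmp_idr L).
- by move=> *; rewrite !(hcmp_id L) !(ccmp_idl L).
- by move=> *; rewrite !(hcmp_id L) !(ccmp_idl L).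
Qed.

Definition colax_id (D : dblcat) : colax D D := Colax (colax_id_laws D).

Lemma colax_cmp_laws (D E G : dblcat) (F : colax D E) (H : colax E G) :
  colax_laws (colax_cmp_data F H).
Proof.
have LD := dbl_laws D; have LE := dbl_laws E; have LG := dbl_laws G.
have LF := cf_laws F; have LH := cf_laws H.
have gc x y z (m : pro x y) (n : pro y z) := cf_comp_glob LF m n.
have gc' x y z (m : pro x y) (n : pro y z) := cf_comp_glob LH m n.
have gu x := cf_unit_glob LF x; have gu' x := cf_unit_glob LH x.
split => /=.
- by move=> x; rewrite (cf_hom_id LF) (cf_hom_id LH).
- by move=> x y z f g; rewrite (cf_hom_cmp LF) (cf_hom_cmp LH).
- by move=> *; rewrite (cf_lside LH) (cf_lside LF).
- by move=> *; rewrite (cf_rside LH) (cf_rside LF).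
- by move=> *; rewrite (cf_cell_id LF) (cf_cell_id LH).
- by move=> *; rewrite (cf_cell_cmp LF) (cf_cell_cmp LH).
- move=> x y z m n; have [a b] := gc _ _ _ m n.
  have [a' b'] := gc' _ _ _ (cf_pro F m) (cf_pro F n).
  split; rewrite /= ?(lside_cmp LG) ?(rside_cmp LG) ?(cf_lside LH)
    ?(cf_rside LH) ?a ?b ?a' ?b' (cf_hom_id LH); exact: cmp_idl.
- move=> x; have [a b] := gu x; have [a' b'] := gu' (F x).
  split; rewrite /= ?(lside_cmp LG) ?(rside_cmp LG) ?(cf_lside LH)
    ?(cf_rside LH) ?a ?b ?a' ?b' (cf_hom_id LH); exact: cmp_idl.
- move=> x y z x' y' z' m n m' n' a b e e'.
  have e1 : rside (cf_cell F a) = lside (cf_cell F b).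
    by rewrite (cf_rside LF) (cf_lside LF) e.
  rewrite (ccmpA LG) -(cf_cell_cmp LH) (cf_comp_nat LF e e1).
  by rewrite (cf_cell_cmp LH) -(ccmpA LG) (cf_comp_nat LH e1 e') (ccmpA LG).
- move=> x y f.
  by rewrite (ccmpA LG) -(cf_cell_cmp LH) (cf_unit_nat LF) (cf_cell_cmp LH)
    -(ccmpA LG) (cf_unit_nat LH) (ccmpA LG).
- move=> x y z w m n p e e'.
  set Fm := cf_pro F m; set Fn := cf_pro F n; set Fp := cf_pro F p.
  have e1 : rside (cid Fm) = lside (cf_comp F n p).
    by rewrite (rside_id LE) (proj1 (gc _ _ _ _ _)).
  have e2 : rside (cf_comp F m n) = lside (cid Fp).
    by rewrite (lside_id LE) (proj2 (gc _ _ _ _ _)).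
  have e1' : rside (cf_cell H (cid Fm)) = lside (cf_cell H (cf_comp F n p)).
    by rewrite (cf_rside LH) (cf_lside LH) e1.
  have e2' : rside (cf_cell H (cf_comp F m n)) = lside (cf_cell H (cid Fp)).
    by rewrite (cf_rside LH) (cf_lside LH) e2.
  have f1 : rside (cid (cf_pro H Fm)) = lside (cf_comp H Fn Fp).
    by rewrite (rside_id LG) (proj1 (gc' _ _ _ _ _)).
  have f2 : rside (cf_comp H Fm Fn) = lside (cid (cf_pro H Fp)).
    by rewrite (lside_id LG) (proj2 (gc' _ _ _ _ _)).
  have i q := cf_cell_id LH (cf_pro F q).
  rewrite (hcmp_cmp_eq e e1' f1 _ eq_refl).
    by rewrite (cf_cell_id LH) (ccmp_idl LG).
  rewrite (hcmp_cmp_eq e' e2' f2 eq_refl).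
    by rewrite (cf_cell_id LH) (ccmp_idl LG).
  rewrite !(ccmpA LG).
  rewrite -(ccmpA LG _ (cf_comp H Fm _)) -(cf_comp_nat LH e1).
  rewrite -(ccmpA LG _ (cf_comp H _ Fp)) -(cf_comp_nat LH e2).
  rewrite !(ccmpA LG) -!(cf_cell_cmp LH).
  have X := cf_assoc LF e1 e2.
  rewrite X !(cf_cell_cmp LH) -!(ccmpA LG).
  have Y := cf_assoc LH f1 f2; rewrite -(ccmpA LG) in Y.
  by rewrite Y -!(ccmpA LG).
- move=> x y m e.
  set Fm := cf_pro F m.
  have e1 : rside (cf_unit F x) = lside (cid Fm).
    by rewrite (lside_id LE) (proj2 (gu _)).
  have e1' : rside (cf_cell H (cf_unit F x)) = lside (cf_cell H (cid Fm)).
    by rewrite (cf_rside LH) (cf_lside LH) e1.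
  have f1 : rside (cf_unit H (F x)) = lside (cid (cf_pro H Fm)).
    by rewrite (lside_id LG) (proj2 (gu' _)).
  rewrite (hcmp_cmp_eq e e1' f1 eq_refl).
    by rewrite (cf_cell_id LH) (ccmp_idl LG).
  rewrite !(ccmpA LG) -(ccmpA LG _ (cf_comp H _ _)) -(cf_comp_nat LH e1).
  rewrite -(cf_lunit LF e1) !(cf_cell_cmp LH) -!(ccmpA LG).
  by have := cf_lunit LH f1; rewrite -(ccmpA LG) => ->.
- move=> x y m e.
  set Fm := cf_pro F m.
  have e1 : rside (cid Fm) = lside (cf_unit F y).
    by rewrite (rside_id LE) (proj1 (gu _)).
  have e1' : rside (cf_cell H (cid Fm)) = lside (cf_cell H (cf_unit F y)).
    by rewrite (cf_rside LH) (cf_lside LH) e1.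
  have f1 : rside (cid (cf_pro H Fm)) = lside (cf_unit H (F y)).
    by rewrite (rside_id LG) (proj1 (gu' _)).
  rewrite (hcmp_cmp_eq e e1' f1 _ eq_refl).
    by rewrite (cf_cell_id LH) (ccmp_idl LG).
  rewrite !(ccmpA LG) -(ccmpA LG _ (cf_comp H _ _)) -(cf_comp_nat LH e1).
  rewrite -(cf_runit LF e1) !(cf_cell_cmp LH) -!(ccmpA LG).
  by have := cf_runit LH f1; rewrite -(ccmpA LG) => ->.
Qed.

Definition colax_cmp (D E G : dblcat) (F : colax D E) (H : colax E G) :
  colax D G := Colax (colax_cmp_laws F H).

Record nattr_data (D E : dbldata) (F G : colax_data D E) := NattrData {
  nt_ob :> forall x : D, hom (F x) (G x);
  nt_pro : forall (x y : D) (m : pro x y), cell (cf_pro F m) (cf_pro G m)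
}.

Arguments nt_pro {D E F G} t {x y} m : rename.

Record nattr_laws (D E : dbldata) (F G : colax_data D E)
    (t : nattr_data F G) : Prop := NattrLaws {
  nt_lside : forall (x y : D) (m : pro x y), lside (nt_pro t m) = t x;
  nt_rside : forall (x y : D) (m : pro x y), rside (nt_pro t m) = t y;
  nt_ob_nat : forall (x y : D) (f : hom x y),
    cf_hom F f >>> t y = t x >>> cf_hom G f;
  nt_pro_nat : forall (x y w z : D) (m : pro x y) (n : pro w z) (a : cell m n),
    cf_cell F a ** nt_pro t n = nt_pro t m ** cf_cell G a;
  nt_comp : forall (x y z : D) (m : pro x y) (n : pro y z) e,
    cf_comp F m n ** hcmp (nt_pro t m) (nt_pro t n) e =
    nt_pro t (m ⊙ n) ** cf_comp G m n;
  nt_unit : forall x : D,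
    cf_unit F x ** cunit (t x) = nt_pro t (punit x) ** cf_unit G x
}.

Record nattr (D E : dblcat) (F G : colax D E) :=
  Nattr { nt_data :> nattr_data F G; nt_laws : nattr_laws nt_data }.

(** [L] is left adjoint to [R] in the 2-category of double categories, colax
    double functors and natural transformations: unit, counit and the two
    triangle identities, the equalities of natural transformations being
    written out on objects and on proarrows. *)
Record adjunction (D E : dblcat) (L : colax D E) (R : colax E D) := Adjunction {
  adj_unit : nattr (colax_id D) (colax_cmp L R);
  adj_counit : nattr (colax_cmp R L) (colax_id E);
  adj_left_ob : forall x : D,
    cf_hom L (adj_unit x) >>> adj_counit (L x) = idm (L x);
  adj_left_pro : forall (x y : D) (m : pro x y),
    cf_cell L (nt_pro adj_unit m) ** nt_pro adj_counit (cf_pro L m)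
    = cid (cf_pro L m);
  adj_right_ob : forall x : E,
    adj_unit (R x) >>> cf_hom R (adj_counit x) = idm (R x);
  adj_right_pro : forall (x y : E) (m : pro x y),
    nt_pro adj_unit (cf_pro R m) ** cf_cell R (nt_pro adj_counit m)
    = cid (cf_pro R m)
}.

(** The cells with a given domain and codomain, over all pairs of sides, from
    the cells [T f g] over a fixed pair (f, g). *)
Record sided (H K : Type) (T : H -> K -> Type) :=
  Sided { sd_l : H; sd_r : K; sd_in : T sd_l sd_r }.

Definition cast_l (H K : Type) (T : H -> K -> Type) (f f' : H) (g : K)
    (e : f = f') (a : T f' g) : T f g :=
  eq_rect_r (fun h => T h g) a e.

Record span (I J : small) :=
  Span { apex : small; lleg : apex -> I; rleg : apex -> J }.

(** [edge A i j] is the set of the elements [a] of [A] with left leg [i] and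
    right leg [j]. *)
Record edge (I J : small) (A : span I J) (i : I) (j : J) :=
  Edge { elt : apex A; elt_l : lleg elt = i; elt_r : rleg elt = j }.

Definition span_id (I : small) : span I I :=
  @Span I I I (fun i => i) (fun i => i).

(** The pullback as the limit of the cospan: triples (j, a, b) with
    [rleg a = j = lleg b]. *)
Record pullback (I J K : small) (A : span I J) (B : span J K) := Pullback {
  pb_mid : J;
  pb_l : apex A;
  pb_r : apex B;
  pb_el : rleg pb_l = pb_mid;
  pb_er : lleg pb_r = pb_mid
}.

Definition span_cmp (I J K : small) (A : span I J) (B : span J K) : span I K :=
  @Span I K (pullback A B) (fun c => lleg (pb_l c)) (fun c => rleg (pb_r c)).

Definition mid (I J K : small) (A : span I J) (B : span J K) i k
    (c : edge (span_cmp A B) i k) : J := pb_mid (elt c).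
Definition ledge (I J K : small) (A : span I J) (B : span J K) i k
    (c : edge (span_cmp A B) i k) : edge A i (mid c) :=
  Edge (elt_l c : lleg (pb_l (elt c)) = i) (pb_el (elt c)).
Definition redge (I J K : small) (A : span I J) (B : span J K) i k
    (c : edge (span_cmp A B) i k) : edge B (mid c) k :=
  Edge (pb_er (elt c)) (elt_r c : rleg (pb_r (elt c)) = k).
Definition pair_edge (I J K : small) (A : span I J) (B : span J K) i j k
    (a : edge A i j) (b : edge B j k) : edge (span_cmp A B) i k :=
  @Edge I K (span_cmp A B) i k (Pullback (elt_r a) (elt_l b))
    (elt_l a) (elt_r b).

Lemma cmp_edge_ind (I J K : small) (A : span I J) (B : span J K) i k
    (P : edge (span_cmp A B) i k -> Prop) :
  (forall j (a : edge A i j) (b : edge B j k), P (pair_edge a b)) ->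
  forall c, P c.
Proof. by move=> H c; exact: (H _ (ledge c) (redge c)). Qed.

Lemma edge_eq (I J : small) (A : span I J) i j (a b : edge A i j) :
  elt a = elt b -> a = b.
Proof.
case: a => a l r; case: b => b l' r' /= E; move: l r; rewrite E => l r.
by rewrite (proof_irrelevance _ l l') (proof_irrelevance _ r r').
Qed.

(** A map of spans over (f, g), presented by its action on edges: it sends the
    [a] with legs i, j to an element with legs f i, g j. *)
Definition span_map (I J I' J' : small) (A : span I J) (B : span I' J')
    (f : I -> I') (g : J -> J') : Type :=
  forall i j, edge A i j -> edge B (f i) (g j).

(** By [span_map_ofP] this is the same as a function between the apexes that
    commutes with the legs. *)
Definition span_map_of (I J I' J' : small) (A : span I J) (B : span I' J')
    (f : I -> I') (g : J -> J') (h : apex A -> apex B)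
    (hl : forall a, lleg (h a) = f (lleg a))
    (hr : forall a, rleg (h a) = g (rleg a)) : span_map A B f g :=
  fun i j a => Edge (eq_trans (hl (elt a)) (f_equal f (elt_l a)))
                    (eq_trans (hr (elt a)) (f_equal g (elt_r a))).

Lemma span_map_ofP (I J I' J' : small) (A : span I J) (B : span I' J')
    (f : I -> I') (g : J -> J') (phi : span_map A B f g) :
  exists! h : apex A -> apex B,
    exists hl hr, phi = span_map_of (f := f) (g := g) (h := h) hl hr.
Proof.
pose h (a : apex A) : apex B := elt (phi _ _ (@Edge _ _ A _ _ a eq_refl eq_refl)).
exists h; split.
  have hl a : lleg (h a) = f (lleg a) by exact: elt_l.
  have hr a : rleg (h a) = g (rleg a) by exact: elt_r.
  exists hl, hr; apply: functional_extensionality_dep => i.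
  apply: functional_extensionality_dep => j.
  apply: functional_extensionality_dep => -[a l r].
  by apply: edge_eq; rewrite /=; case: _ / l; case: _ / r.
by move=> h' [hl [hr E]]; apply: functional_extensionality => a; rewrite /h E.
Qed.

Section Families.
Context (D : dblcat).
Local Notation L := (dbl_laws D).

Record fam_ob := FamOb { fidx : small; fval :> fidx -> D }.

Record fam_hom (X Y : fam_ob) := FamHom {
  fh_idx : fidx X -> fidx Y;
  fh_arr : forall i, hom (X i) (Y (fh_idx i))
}.

Definition fam_idm (X : fam_ob) : fam_hom X X :=
  @FamHom X X (fun i => i) (fun i => idm (X i)).

Definition fam_cmp (X Y Z : fam_ob) (f : fam_hom X Y) (g : fam_hom Y Z) :
    fam_hom X Z :=
  @FamHom X Z (fun i => fh_idx g (fh_idx f i))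
    (fun i => fh_arr f i >>> fh_arr g (fh_idx f i)).

Lemma fam_hom_eq (X Y : fam_ob) (h : fidx X -> fidx Y)
    (f g : forall i, hom (X i) (Y (h i))) :
  (forall i, f i = g i) -> FamHom f = FamHom g.
Proof. by move=> E; rewrite (functional_extensionality_dep f g E). Qed.

Definition fam_cat : category.
Proof.
refine (@Category fam_ob fam_hom fam_idm fam_cmp _ _ _).
- by move=> X Y f; apply: fam_hom_eq => i; exact: cmp_idl.
- by move=> X Y f; apply: fam_hom_eq => i; exact: cmp_idr.
- by move=> X Y Z W f g h; apply: fam_hom_eq => i; exact: cmpA.
Defined.

Record fam_pro (X Y : fam_ob) := FamPro {
  fspan : span (fidx X) (fidx Y);
  fpro :> forall i j, edge fspan i j -> pro (X i) (Y j)
}.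

Arguments fpro {X Y} f {i j} a : rename.

Record fam_over (X Y W Z : fam_ob) (m : fam_pro X Y) (n : fam_pro W Z)
    (f : fam_hom X W) (g : fam_hom Y Z) := FamOver {
  fo_map : span_map (fspan m) (fspan n) (fh_idx f) (fh_idx g);
  fo_cell : forall i j (a : edge (fspan m) i j),
    cell (fpro m a) (fpro n (fo_map a));
  fo_l : forall i j (a : edge (fspan m) i j), lside (fo_cell a) = fh_arr f i;
  fo_r : forall i j (a : edge (fspan m) i j), rside (fo_cell a) = fh_arr g j
}.

Definition fam_cell (X Y W Z : fam_ob) (m : fam_pro X Y) (n : fam_pro W Z) :=
  sided (fam_over m n).

(** Edges and cells out of [m] bundled, to compare cells of families whose maps
    of spans are not convertible. *)
Record fam_target (W Z : fam_ob) (x y : D) (m : pro x y) (n : fam_pro W Z) :=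
  FamTarget {
    ft_i : fidx W;
    ft_j : fidx Z;
    ft_edge : edge (fspan n) ft_i ft_j;
    ft_cell : cell m (fpro n ft_edge)
  }.

Definition fc_target (X Y W Z : fam_ob) (m : fam_pro X Y) (n : fam_pro W Z)
    (al : fam_cell m n) i j (a : edge (fspan m) i j) : fam_target (fpro m a) n :=
  FamTarget (fo_cell (sd_in al) a).

Lemma fam_target_inj (W Z : fam_ob) (x y : D) (m : pro x y) (n : fam_pro W Z)
    i j (b b' : edge (fspan n) i j) (c : cell m (fpro n b))
    (c' : cell m (fpro n b')) :
  FamTarget c = FamTarget c' ->
  existT (fun b => cell m (fpro n b)) b c = existT _ b' c'.
Proof.
pose P (t : fam_target m n) := forall (ei : ft_i t = i) (ej : ft_j t = j),
  existT (fun b => cell m (fpro n b)) b c =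
  match ei in _ = i', ej in _ = j' return
    {b : edge (fspan n) i' j' & cell m (fpro n b)} with
  | eq_refl, eq_refl => existT _ (ft_edge t) (ft_cell t)
  end.
move=> E; have : P (FamTarget c).
  move=> /= ei ej.
  by rewrite (proof_irrelevance _ ei eq_refl) (proof_irrelevance _ ej eq_refl).
by rewrite E => H; exact: (H eq_refl eq_refl).
Qed.

Lemma fam_cell_eq (X Y W Z : fam_ob) (m : fam_pro X Y) (n : fam_pro W Z)
    (al be : fam_cell m n) :
  sd_l al = sd_l be -> sd_r al = sd_r be ->
  (forall i j (a : edge (fspan m) i j), fc_target al a = fc_target be a) ->
  al = be.
Proof.
case: al => f g al; case: be => f' g' be /= ef eg.
case: _ / ef be; case: _ / eg => be E.
case: al E => p c l r; case: be => p' c' l' r' E.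
have {}E : (fun i j (a : edge (fspan m) i j) =>
    existT (fun b => cell (fpro m a) (fpro n b)) (p i j a) (c i j a)) =
  (fun i j a => existT _ (p' i j a) (c' i j a)).
  apply: functional_extensionality_dep => i.
  apply: functional_extensionality_dep => j.
  apply: functional_extensionality_dep => a.
  exact: fam_target_inj (E i j a).
pose T := forall i j (a : edge (fspan m) i j),
  {b : edge (fspan n) (fh_idx f i) (fh_idx g j) & cell (fpro m a) (fpro n b)}.
pose mk (t : T) hl hr : fam_cell m n :=
  @Sided _ _ (fam_over m n) f g
    (@FamOver X Y W Z m n f g (fun i j a => projT1 (t i j a))
     (fun i j a => projT2 (t i j a)) hl hr).
change (mk (fun i j a => existT _ (p i j a) (c i j a)) l r =
        mk (fun i j a => existT _ (p' i j a) (c' i j a)) l' r').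
have K (t t' : T) hl hr hl' hr' : t = t' -> mk t hl hr = mk t' hl' hr'.
  move=> e; move: hl hr; rewrite e => hl hr.
  by rewrite (proof_irrelevance _ hl hl') (proof_irrelevance _ hr hr').
exact: K E.
Qed.

Definition fam_cid (X Y : fam_ob) (m : fam_pro X Y) : fam_cell m m.
Proof.
exists (fam_idm X) (fam_idm Y).
exists (fun i j a => a) (fun i j a => cid (fpro m a)).
- by move=> i j a; exact: (lside_id L).
- by move=> i j a; exact: (rside_id L).
Defined.

Definition fam_ccmp (X Y W Z U V : fam_ob) (m : fam_pro X Y) (n : fam_pro W Z)
    (p : fam_pro U V) (al : fam_cell m n) (be : fam_cell n p) : fam_cell m p.
Proof.
exists (fam_cmp (sd_l al) (sd_l be)) (fam_cmp (sd_r al) (sd_r be)).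
exists (fun i j a => fo_map (sd_in be) (fo_map (sd_in al) a))
  (fun i j a => fo_cell (sd_in al) a ** fo_cell (sd_in be) (fo_map (sd_in al) a)).
- by move=> i j a; rewrite (lside_cmp L) !fo_l.
- by move=> i j a; rewrite (rside_cmp L) !fo_r.
Defined.

Definition fam_odot (X Y Z : fam_ob) (m : fam_pro X Y) (n : fam_pro Y Z) :
    fam_pro X Z :=
  @FamPro X Z (span_cmp (fspan m) (fspan n))
    (fun i k c => fpro m (ledge c) ⊙ fpro n (redge c)).

Definition fam_hcmp_over (X Y Z X' Y' Z' : fam_ob)
    (m : fam_pro X Y) (n : fam_pro Y Z) (m' : fam_pro X' Y')
    (n' : fam_pro Y' Z') f g h (al : fam_over m m' f g)
    (be : fam_over n n' g h) : fam_over (fam_odot m n) (fam_odot m' n') f h.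
Proof.
exists (fun i k c => pair_edge (fo_map al (ledge c)) (fo_map be (redge c)))
  (fun i k c => hcmp (fo_cell al (ledge c)) (fo_cell be (redge c))
     (eq_trans (fo_r al (ledge c)) (eq_sym (fo_l be (redge c))))).
- by move=> i k c; rewrite (lside_hcmp L) fo_l.
- by move=> i k c; rewrite (rside_hcmp L) fo_r.
Defined.

Definition fam_hcmp (X Y Z X' Y' Z' : fam_ob)
    (m : fam_pro X Y) (n : fam_pro Y Z) (m' : fam_pro X' Y')
    (n' : fam_pro Y' Z') (al : fam_cell m m') (be : fam_cell n n')
    (e : sd_r al = sd_l be) : fam_cell (fam_odot m n) (fam_odot m' n') :=
  Sided (fam_hcmp_over (sd_in al) (cast_l e (sd_in be))).

(** An edge of [span_id] from i to j is an element equal to both i and j. *)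
Definition fam_unit_pro (X : fam_ob) i j (a : edge (span_id (fidx X)) i j) :
    pro (X i) (X j) :=
  match elt_l a in _ = i', elt_r a in _ = j' return pro (X i') (X j') with
  | eq_refl, eq_refl => punit (X (elt a))
  end.

Definition fam_punit (X : fam_ob) : fam_pro X X := FamPro (@fam_unit_pro X).

Definition fam_cunit_cell (X Y : fam_ob) (f : fam_hom X Y) i j
    (a : edge (span_id (fidx X)) i j) :
    cell (fam_unit_pro a)
      (fam_unit_pro (@Edge _ _ (span_id (fidx Y)) _ _ (fh_idx f (elt a))
        (f_equal (fh_idx f) (elt_l a)) (f_equal (fh_idx f) (elt_r a)))).
Proof.
case: a => i0 e1 e2 /=; case: _ / e1; case: _ / e2.
exact: (cunit (fh_arr f i0)).
Defined.

Definition fam_cunit (X Y : fam_ob) (f : fam_hom X Y) :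
  fam_cell (fam_punit X) (fam_punit Y).
Proof.
exists f f.
exists (fun i j (a : edge (span_id (fidx X)) i j) =>
    @Edge _ _ (span_id (fidx Y)) _ _ (fh_idx f (elt a))
      (f_equal (fh_idx f) (elt_l a)) (f_equal (fh_idx f) (elt_r a)))
  (fun i j a => fam_cunit_cell f a).
- move=> i j [i0 e1 e2] /=; case: _ / e1; case: _ / e2; exact: (lside_cunit L).
- move=> i j [i0 e1 e2] /=; case: _ / e1; case: _ / e2; exact: (rside_cunit L).
Defined.

Definition fam_dassoc (X Y Z W : fam_ob) (m : fam_pro X Y) (n : fam_pro Y Z)
    (p : fam_pro Z W) :
  fam_cell (fam_odot (fam_odot m n) p) (fam_odot m (fam_odot n p)).
Proof.
exists (fam_idm X) (fam_idm W).
exists (fun i l c => pair_edge (ledge (ledge c))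
                       (pair_edge (redge (ledge c)) (redge c)))
  (fun i l c => dassoc (fpro m (ledge (ledge c))) (fpro n (redge (ledge c)))
                  (fpro p (redge c))).
- by move=> i l c; exact: (proj1 (dassoc_glob L _ _ _)).
- by move=> i l c; exact: (proj2 (dassoc_glob L _ _ _)).
Defined.

Definition lun_edge (I J : small) (A : span I J) i j k
    (a : edge (span_id I) i j) (b : edge A j k) : edge A i k :=
  Edge (eq_trans (elt_l b) (eq_trans (eq_sym (elt_r a : elt a = j)) (elt_l a))) (elt_r b).

Definition run_edge (I J : small) (A : span I J) i j k
    (a : edge A i j) (b : edge (span_id J) j k) : edge A i k :=
  Edge (elt_l a) (eq_trans (elt_r a) (eq_trans (eq_sym (elt_l b : elt b = j)) (elt_r b))).

Definition fam_lun_cell (X Y : fam_ob) (m : fam_pro X Y) i j k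
    (a : edge (span_id (fidx X)) i j) (b : edge (fspan m) j k) :
  cell (fam_unit_pro a ⊙ fpro m b) (fpro m (lun_edge a b)).
Proof.
case: a => i0 e1 e2 /=; case: _ / e1; move: b; case: _ / e2 => b.
exact: (dlunit (fpro m b)).
Defined.

Definition fam_run_cell (X Y : fam_ob) (m : fam_pro X Y) i j k
    (a : edge (fspan m) i j) (b : edge (span_id (fidx Y)) j k) :
  cell (fpro m a ⊙ fam_unit_pro b) (fpro m (run_edge a b)).
Proof.
case: b => j0 e1 e2 /=; case: _ / e2; move: a; case: _ / e1 => a.
exact: (drunit (fpro m a)).
Defined.

Definition fam_dlunit (X Y : fam_ob) (m : fam_pro X Y) :
  fam_cell (fam_odot (fam_punit X) m) m.
Proof.
exists (fam_idm X) (fam_idm Y).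
exists (fun i k c => lun_edge (ledge c) (redge c))
  (fun i k c => fam_lun_cell (ledge c) (redge c)).
- move=> i k; apply: cmp_edge_ind => j [i0 e1 e2] b /=.
  case: _ / e1; move: b; case: _ / e2 => b.
  exact: (proj1 (dlunit_glob L _)).
- move=> i k; apply: cmp_edge_ind => j [i0 e1 e2] b /=.
  case: _ / e1; move: b; case: _ / e2 => b.
  exact: (proj2 (dlunit_glob L _)).
Defined.

Definition fam_drunit (X Y : fam_ob) (m : fam_pro X Y) :
  fam_cell (fam_odot m (fam_punit Y)) m.
Proof.
exists (fam_idm X) (fam_idm Y).
exists (fun i k c => run_edge (ledge c) (redge c))
  (fun i k c => fam_run_cell (ledge c) (redge c)).
- move=> i k; apply: cmp_edge_ind => j a [j0 e1 e2] /=.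
  case: _ / e2; move: a; case: _ / e1 => a.
  exact: (proj1 (drunit_glob L _)).
- move=> i k; apply: cmp_edge_ind => j a [j0 e1 e2] /=.
  case: _ / e2; move: a; case: _ / e1 => a.
  exact: (proj2 (drunit_glob L _)).
Defined.

Definition fam_data : dbldata :=
  @DblData fam_cat fam_pro fam_cell
    (fun X Y W Z m n al => sd_l al) (fun X Y W Z m n al => sd_r al)
    fam_cid fam_ccmp fam_odot fam_hcmp fam_punit fam_cunit
    fam_dassoc fam_dlunit fam_drunit.

Lemma fc_target_eq (W Z : fam_ob) (n : fam_pro W Z) x y (q : pro x y) i j (b : edge (fspan n) i j)
    (c c' : cell q (fpro n b)) :
  c = c' -> FamTarget c = FamTarget c'.
Proof. by move=> ->. Qed.

(** A cell of families over identities is invertible as soon as its map of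
    spans is bijective on edges and its components are invertible. *)
Lemma fam_cell_invertible (X Y : fam_ob) (m n : fam_pro X Y)
    (al : fam_over m n (fam_idm X) (fam_idm Y))
    (psi : forall i j, edge (fspan n) i j -> edge (fspan m) i j) :
  (forall i j a, psi i j (fo_map al a) = a) ->
  (forall i j b, fo_map al (psi i j b) = b) ->
  (forall i j (a : edge (fspan m) i j), cell_invertible (fo_cell al a)) ->
  @cell_invertible fam_data _ _ _ _ m n (Sided al).
Proof.
move=> K K' inv.
pose iv i j (a : edge (fspan m) i j) :=
  proj1_sig (constructive_indefinite_description _ (inv i j a)).
have ivP i j (a : edge (fspan m) i j) :
    fo_cell al a ** iv i j a = cid _ /\ iv i j a ** fo_cell al a = cid _.
  by rewrite /iv; case: constructive_indefinite_description.
have ivl i j (a : edge (fspan m) i j) : lside (iv i j a) = idm (X i).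
  have := f_equal lside (proj1 (ivP i j a)).
  by rewrite (lside_cmp L) (lside_id L) fo_l /= cmp_idl.
have ivr i j (a : edge (fspan m) i j) : rside (iv i j a) = idm (Y j).
  have := f_equal rside (proj1 (ivP i j a)).
  by rewrite (rside_cmp L) (rside_id L) fo_r /= cmp_idl.
pose tr i j (a : edge (fspan m) i j) (b : edge (fspan n) i j)
    (e : fo_map al a = b) : cell (fpro n b) (fpro m a) :=
  eq_rect (fo_map al a) (fun b' => cell (fpro n b') (fpro m a)) (iv i j a) b e.
have trl i j a b e : lside (tr i j a b e) = idm (X i).
  by rewrite /tr; case: _ / e; exact: ivl.
have trr i j a b e : rside (tr i j a b e) = idm (Y j).
  by rewrite /tr; case: _ / e; exact: ivr.
exists (@Sided _ _ (fam_over n m) (fam_idm X) (fam_idm Y)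
  (@FamOver _ _ _ _ n m (fam_idm X) (fam_idm Y) psi
     (fun i j b => tr i j (psi i j b) b (K' i j b))
     (fun i j b => trl i j _ _ _) (fun i j b => trr i j _ _ _))).
split; apply: fam_cell_eq => /=.
- by apply: fam_hom_eq => i; exact: cmp_idl.
- by apply: fam_hom_eq => i; exact: cmp_idl.
- move=> i j a; rewrite /fc_target /=.
  have H a' (ea : a' = a) (E : fo_map al a' = fo_map al a) :
     FamTarget (fo_cell al a ** tr i j a' _ E) = FamTarget (cid (fpro m a)).
    subst a'; rewrite (proof_irrelevance _ E eq_refl) /=.
    by rewrite (proj1 (ivP i j a)).
  exact: H (K i j a) _.
- by apply: fam_hom_eq => i; exact: cmp_idl.
- by apply: fam_hom_eq => i; exact: cmp_idl.
- move=> i j b; rewrite /fc_target /=.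
  have H a b' (E : fo_map al a = b') :
     FamTarget (tr i j a b' E ** fo_cell al a) = FamTarget (cid (fpro n b')).
    by case: _ / E => /=; rewrite (proj2 (ivP i j a)).
  exact: H.
Qed.

Lemma fam_laws : dbllaws fam_data.
Proof.
have FI := @cmp_idl fam_cat; have FR := @cmp_idr fam_cat.
have FA := @cmpA fam_cat.
split.
- move=> X Y W Z m n a; apply: fam_cell_eq; [exact: FI|exact: FI|].
  move=> i j e; apply: fc_target_eq; exact: (ccmp_idl L).
- move=> X Y W Z m n a; apply: fam_cell_eq; [exact: FR|exact: FR|].
  move=> i j e; apply: fc_target_eq; exact: (ccmp_idr L).
- move=> X Y W Z U V S T m n p q a b c.
  apply: fam_cell_eq; [exact: FA|exact: FA|].
  move=> i j e; apply: fc_target_eq; exact: (ccmpA L).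
- by [].
- by [].
- by [].
- by [].
- by [].
- by [].
- move=> X Y Z m n e; apply: fam_cell_eq => // i k c.
  rewrite (proof_irrelevance _ e eq_refl).
  apply: fc_target_eq; exact: (hcmp_id L).
- move=> X Y Z X' Y' Z' X'' Y'' Z'' m n m' n' m'' n'' [f g a] [g1 h b]
    [f' g' a'] [g1' h' b'] /= e e' e''.
  destruct e, e'; rewrite (proof_irrelevance _ e'' eq_refl).
  apply: fam_cell_eq => // i k c.
  apply: fc_target_eq; exact: (hcmp_cmp L).
- by [].
- by [].
- move=> X; apply: fam_cell_eq => // i k [i0 e1 e2]; destruct e1, e2.
  apply: fc_target_eq; exact: (cunit_id L).
- move=> X Y Z f g; apply: fam_cell_eq => // i k [i0 e1 e2]; destruct e1, e2.
  apply: fc_target_eq; exact: (cunit_cmp L).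
- by [].
- move=> X Y Z W m n p.
  apply: (@fam_cell_invertible X W _ _ (sd_in (fam_dassoc m n p)) (fun i l c =>
    pair_edge (pair_edge (ledge c) (ledge (redge c))) (redge (redge c)))) => //.
  move=> i l c; exact: (dassoc_inv L).
- move=> X Y Z W X' Y' Z' W' m n p m' n' p' [f g a] [g1 h b] [h1 k c]
    /= e1 e2 e3 e4.
  destruct e1, e2; rewrite (proof_irrelevance _ e3 eq_refl).
  rewrite (proof_irrelevance _ e4 eq_refl).
  apply: fam_cell_eq; [by rewrite [LHS]FR [RHS]FI|by rewrite [LHS]FR [RHS]FI|].
  move=> i l c0.
  apply: fc_target_eq; exact: (dassoc_nat L).
- by [].
- move=> X Y m.
  apply: (@fam_cell_invertible X Y _ _ (sd_in (fam_dlunit m)) (fun i k b => pair_edge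
    (@Edge _ _ (span_id (fidx X)) i i i eq_refl eq_refl) b)).
  + move=> i k; apply: cmp_edge_ind => j [i0 e1 e2] b /=.
    by destruct e1, e2.
  + by [].
  + move=> i k; apply: cmp_edge_ind => j [i0 e1 e2] b /=.
    destruct e1, e2; exact: (dlunit_inv L).
- move=> X Y X' Y' m m' [f g a] /= e; rewrite (proof_irrelevance _ e eq_refl).
  apply: fam_cell_eq; [by rewrite [LHS]FR [RHS]FI|by rewrite [LHS]FR [RHS]FI|].
  move=> i k; apply: cmp_edge_ind => j [i0 e1 e2] b.
  destruct e1, e2; apply: fc_target_eq.
  have e0 : rside (cunit (lside (fo_cell a b))) = lside (fo_cell a b).
    exact: (rside_cunit L).
  apply: (eq_trans _ (dlunit_nat L e0)); congr (_ ** _); apply: hcmp_irr => //.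
  by rewrite fo_l.
- by [].
- move=> X Y m.
  apply: (@fam_cell_invertible X Y _ _ (sd_in (fam_drunit m)) (fun i k b => pair_edge
    b (@Edge _ _ (span_id (fidx Y)) k k k eq_refl eq_refl))).
  + move=> i k; apply: cmp_edge_ind => j b [i0 e1 e2] /=.
    by destruct e2, e1.
  + by [].
  + move=> i k; apply: cmp_edge_ind => j b [i0 e1 e2] /=.
    destruct e2, e1; exact: (drunit_inv L).
- move=> X Y X' Y' m m' [f g a] /= e; rewrite (proof_irrelevance _ e eq_refl).
  apply: fam_cell_eq; [by rewrite [LHS]FR [RHS]FI|by rewrite [LHS]FR [RHS]FI|].
  move=> i k; apply: cmp_edge_ind => j b [i0 e1 e2].
  destruct e2, e1; apply: fc_target_eq.
  have e0 : rside (fo_cell a b) = lside (cunit (rside (fo_cell a b))).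
    by rewrite (lside_cunit L).
  apply: (eq_trans _ (drunit_nat L e0)); congr (_ ** _); apply: hcmp_irr => //.
  by rewrite fo_r.
- move=> X Y Z m n e e'.
  rewrite (proof_irrelevance _ e eq_refl) (proof_irrelevance _ e' eq_refl).
  apply: fam_cell_eq; [by rewrite [LHS]FR|by rewrite [LHS]FR|].
  move=> i k; apply: cmp_edge_ind => j c b; move: c.
  apply: cmp_edge_ind => j' a [i0 e1 e2].
  destruct e1, e2; apply: fc_target_eq; exact: (dtriangle L).
- move=> X Y Z W V m n p q e e'.
  rewrite (proof_irrelevance _ e eq_refl) (proof_irrelevance _ e' eq_refl).
  apply: fam_cell_eq; [by rewrite [LHS]FR|by rewrite [LHS]FR|].
  move=> i k c; apply: fc_target_eq; exact: (dpentagon L).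
Qed.

End Families.

Definition fam (D : dblcat) : dblcat := DblCat (fam_laws D).

Section Diagonal.
Context (D : dblcat).
Local Notation L := (dbl_laws D).

Definition span_one : span unit unit :=
  @Span unit unit unit (fun _ => tt) (fun _ => tt).

Definition tt_eq (i : unit) : tt = i := match i with tt => eq_refl end.

Definition edge_one (i j : unit) : edge span_one i j :=
  @Edge unit unit span_one i j tt (tt_eq i) (tt_eq j).

Definition diag_ob (x : D) : fam D := @FamOb D unit (fun _ => x).

Definition diag_hom (x y : D) (f : hom x y) : hom (diag_ob x) (diag_ob y) :=
  @FamHom D (diag_ob x) (diag_ob y) (fun i => i) (fun _ => f).

Definition diag_pro (x y : D) (m : pro x y) : pro (diag_ob x) (diag_ob y) :=
  @FamPro D (diag_ob x) (diag_ob y) span_one (fun _ _ _ => m).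

Definition diag_cell (x y w z : D) (m : pro x y) (n : pro w z) (a : cell m n) :
    cell (diag_pro m) (diag_pro n) :=
  @Sided _ _ (fam_over (diag_pro m) (diag_pro n))
    (diag_hom (lside a)) (diag_hom (rside a))
    (@FamOver D _ _ _ _ (diag_pro m) (diag_pro n)
      (diag_hom (lside a)) (diag_hom (rside a))
      (fun _ _ e => e) (fun _ _ _ => a)
      (fun _ _ _ => eq_refl) (fun _ _ _ => eq_refl)).

Definition diag_comp (x y z : D) (m : pro x y) (n : pro y z) :
    cell (diag_pro (m ⊙ n)) (diag_pro m ⊙ diag_pro n) :=
  @Sided _ _ (fam_over (diag_pro (m ⊙ n)) (diag_pro m ⊙ diag_pro n))
    (fam_idm (diag_ob x)) (fam_idm (diag_ob z))
    (@FamOver D _ _ _ _ (diag_pro (m ⊙ n)) (diag_pro m ⊙ diag_pro n)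
      (fam_idm (diag_ob x)) (fam_idm (diag_ob z))
      (fun i k _ => pair_edge (edge_one i tt) (edge_one tt k))
      (fun _ _ _ => cid (m ⊙ n))
      (fun _ _ _ => lside_id L _) (fun _ _ _ => rside_id L _)).

Definition diag_unit_cell (x : D) (i j : unit) :
    cell (punit x) (fam_unit_pro (X := diag_ob x)
      (@Edge unit unit (span_id unit) i j tt (tt_eq i) (tt_eq j))) :=
  match i, j with tt, tt => cid (punit x) end.

Definition diag_unit (x : D) : cell (diag_pro (punit x)) (punit (diag_ob x)).
Proof.
exists (fam_idm (diag_ob x)) (fam_idm (diag_ob x)).
exists (fun i j _ => @Edge unit unit (span_id unit) i j tt (tt_eq i) (tt_eq j))
  (fun i j _ => diag_unit_cell x i j).
- by move=> [] [] e; exact: (lside_id L).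
- by move=> [] [] e; exact: (rside_id L).
Defined.

Definition diag_data : colax_data D (fam D) :=
  @ColaxData D (fam D) diag_ob diag_hom diag_pro diag_cell diag_comp diag_unit.

Lemma unit_eq (i j : unit) : i = j.
Proof. by case: i; case: j. Qed.

Lemma pullback_eq (I J K : small) (A : span I J) (B : span J K)
    (c c' : pullback A B) :
  pb_mid c = pb_mid c' -> pb_l c = pb_l c' -> pb_r c = pb_r c' -> c = c'.
Proof.
case: c => j a b l r; case: c' => [j' a' b' l' r'] /= E E1 E2; destruct E, E1, E2.
by rewrite (proof_irrelevance _ l l') (proof_irrelevance _ r r').
Qed.

Lemma const_target_eq (W Z : fam_ob D) (S : span (fidx W) (fidx Z))
    (q : forall i j, pro (W i) (Z j)) (x y : D) (m : pro x y) i j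
    (b b' : edge S i j) (c c' : cell m (q i j)) :
  elt b = elt b' -> c = c' ->
  @FamTarget D W Z x y m (@FamPro D W Z S (fun i j _ => q i j)) i j b c =
  @FamTarget D W Z x y m (@FamPro D W Z S (fun i j _ => q i j)) i j b' c'.
Proof. by move=> E ->; have Eb := edge_eq E; subst b'. Qed.

Lemma diag_laws : colax_laws diag_data.
Proof.
have FI := @cmp_idl (fam_cat D); have FR := @cmp_idr (fam_cat D).
split.
- by [].
- by [].
- by [].
- by [].
- move=> x y m; apply: fam_cell_eq => //=.
  + by rewrite (lside_id L).
  + by rewrite (rside_id L).
- move=> x y w z u v m n p a b; apply: fam_cell_eq => //=.
  + by rewrite (lside_cmp L).
  + by rewrite (rside_cmp L).
- by [].
- by [].
- move=> x y z x' y' z' m n m' n' a b e e'.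
  apply: fam_cell_eq.
  + by rewrite [LHS]FR [RHS]FI /= (lside_hcmp L).
  + by rewrite [LHS]FR [RHS]FI /= (rside_hcmp L).
  + move=> i k c.
  apply: (@const_target_eq (diag_ob x') (diag_ob z') (span_cmp span_one span_one)
    (fun _ _ => m' ⊙ n')); first by apply: pullback_eq; exact: unit_eq.
  rewrite /= (ccmp_idr L) (ccmp_idl L).
    apply: hcmp_irr => //; symmetry.
    have E f (ef : f = diag_hom (lside b)) i' j'
          (c' : edge (fspan (diag_pro n)) i' j') :
        @fo_cell D _ _ _ _ (diag_pro n) (diag_pro n') f (diag_hom (rside b))
          (cast_l ef (sd_in (diag_cell b))) i' j' c' = b :> cell n n'.
      by subst f.
    exact: E.
- move=> x y f; apply: fam_cell_eq.
  + by rewrite [LHS]FR [RHS]FI /= (lside_cunit L).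
  + by rewrite [LHS]FR [RHS]FI /= (rside_cunit L).
  + move=> [] [] c; apply: fc_target_eq => /=.
  by rewrite (ccmp_idl L) (ccmp_idr L).
- move=> x y z w m n p e e'; apply: fam_cell_eq.
  + by rewrite /= (proj1 (dassoc_glob L _ _ _)) [LHS]FR [RHS]FR.
  + by rewrite /= (proj2 (dassoc_glob L _ _ _)) [LHS]FR [RHS]FR.
  + move=> i k c; rewrite (proof_irrelevance _ e eq_refl).
  rewrite (proof_irrelevance _ e' eq_refl).
  apply: (@const_target_eq (diag_ob x) (diag_ob w)
    (span_cmp span_one (span_cmp span_one span_one))
    (fun _ _ => m ⊙ (n ⊙ p))).
    by apply: pullback_eq; rewrite /=; try exact: unit_eq;
       apply: pullback_eq; exact: unit_eq.
  by rewrite /= !(hcmp_id L) !(ccmp_idl L) !(ccmp_idr L).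
- move=> x y m e; rewrite (proof_irrelevance _ e eq_refl); apply: fam_cell_eq.
  + by rewrite /= (proj1 (dlunit_glob L _)) [LHS]FR.
  + by rewrite /= (proj2 (dlunit_glob L _)) [LHS]FR.
  + move=> [] [] c.
  apply: (@const_target_eq (diag_ob x) (diag_ob y) span_one (fun _ _ => m)); first exact: unit_eq.
  by rewrite /= !(hcmp_id L) !(ccmp_idl L).
- move=> x y m e; rewrite (proof_irrelevance _ e eq_refl); apply: fam_cell_eq.
  + by rewrite /= (proj1 (drunit_glob L _)) [LHS]FR.
  + by rewrite /= (proj2 (drunit_glob L _)) [LHS]FR.
  + move=> [] [] c.
  apply: (@const_target_eq (diag_ob x) (diag_ob y) span_one (fun _ _ => m)); first exact: unit_eq.
  by rewrite /= !(hcmp_id L) !(ccmp_idl L).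
Qed.

Definition diag : colax D (fam D) := Colax diag_laws.

End Diagonal.

Lemma diag_pseudo (D : dblcat) : is_pseudo (diag D).
Proof.
split.
- move=> x y z m n; apply: (@fam_cell_invertible D _ _ _ _
    (sd_in (diag_comp m n)) (fun i k _ => edge_one i k)).
  + by move=> i k a; apply: edge_eq; exact: unit_eq.
  + by move=> i k b; apply: edge_eq; apply: pullback_eq; exact: unit_eq.
  + move=> i k a; exists (cid (m ⊙ n)).
    by split; exact: (ccmp_idl (dbl_laws D)).
- move=> x; apply: (@fam_cell_invertible D _ _ _ _
    (sd_in (diag_unit x)) (fun i k _ => edge_one i k)).
  + by move=> i k a; apply: edge_eq; exact: unit_eq.
  + by move=> i k b; apply: edge_eq; exact: unit_eq.
  + move=> [] [] a; exists (cid (punit x)).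
    by split; exact: (ccmp_idl (dbl_laws D)).
Qed.

Definition has_colax_coproducts (D : dblcat) : Prop :=
  exists Sigma : colax (fam D) D, inhabited (adjunction Sigma (diag D)).

Definition has_strong_coproducts (D : dblcat) : Prop :=
  exists Sigma : colax (fam D) D,
    inhabited (adjunction Sigma (diag D)) /\ is_pseudo Sigma.

Record symmon := SymMon {
  sm_cat :> category;
  tens : sm_cat -> sm_cat -> sm_cat;
  tensh : forall x x' y y' : sm_cat,
    hom x x' -> hom y y' -> hom (tens x y) (tens x' y');
  munit : sm_cat;
  massoc : forall x y z : sm_cat,
    hom (tens (tens x y) z) (tens x (tens y z));
  mlun : forall x : sm_cat, hom (tens munit x) x;
  mrun : forall x : sm_cat, hom (tens x munit) x;
  msym : forall x y : sm_cat, hom (tens x y) (tens y x);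
  tensh_id : forall x y : sm_cat, tensh (idm x) (idm y) = idm (tens x y);
  tensh_cmp : forall (x x' x'' y y' y'' : sm_cat) (f : hom x x')
    (f' : hom x' x'') (g : hom y y') (g' : hom y' y''),
    tensh (f >>> f') (g >>> g') = tensh f g >>> tensh f' g';
  massoc_inv : forall x y z : sm_cat, invertible (massoc x y z);
  mlun_inv : forall x : sm_cat, invertible (mlun x);
  mrun_inv : forall x : sm_cat, invertible (mrun x);
  massoc_nat : forall (x x' y y' z z' : sm_cat) (f : hom x x') (g : hom y y')
    (h : hom z z'),
    tensh (tensh f g) h >>> massoc x' y' z' =
    massoc x y z >>> tensh f (tensh g h);
  mlun_nat : forall (x x' : sm_cat) (f : hom x x'),
    tensh (idm munit) f >>> mlun x' = mlun x >>> f;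
  mrun_nat : forall (x x' : sm_cat) (f : hom x x'),
    tensh f (idm munit) >>> mrun x' = mrun x >>> f;
  msym_nat : forall (x x' y y' : sm_cat) (f : hom x x') (g : hom y y'),
    tensh f g >>> msym x' y' = msym x y >>> tensh g f;
  mpentagon : forall x y z w : sm_cat,
    tensh (massoc x y z) (idm w) >>> massoc x (tens y z) w
      >>> tensh (idm x) (massoc y z w) =
    massoc (tens x y) z w >>> massoc x y (tens z w);
  mtriangle : forall x y : sm_cat,
    massoc x munit y >>> tensh (idm x) (mlun y) = tensh (mrun x) (idm y);
  mhexagon : forall x y z : sm_cat,
    massoc x y z >>> msym x (tens y z) >>> massoc y z x =
    tensh (msym x y) (idm z) >>> massoc y x z >>> tensh (idm y) (msym x z);
  msymK : forall x y : sm_cat, msym x y >>> msym y x = idm (tens x y)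
}.

Arguments tens {s} x y.
Arguments tensh {s x x' y y'} f g.
Arguments munit {s}.
Arguments massoc {s} x y z.
Arguments mlun {s} x.
Arguments mrun {s} x.
Arguments msym {s} x y.

Infix "⊗" := tens (at level 40, left associativity).
Infix "⊠" := tensh (at level 40, left associativity).

Record coproducts (C : category) := Coproducts {
  coprod : forall I : small, (I -> C) -> C;
  inj : forall (I : small) (X : I -> C) (i : I), hom (X i) (coprod X);
  copair : forall (I : small) (X : I -> C) (T : C),
    (forall i, hom (X i) T) -> hom (coprod X) T;
  copair_inj : forall (I : small) (X : I -> C) (T : C)
    (f : forall i, hom (X i) T) i, inj X i >>> copair f = f i;
  copair_uniq : forall (I : small) (X : I -> C) (T : C) (h k : hom (coprod X) T),
    (forall i, inj X i >>> h = inj X i >>> k) -> h = k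
}.

Arguments coprod {C} c {I} X : rename.
Arguments inj {C} c {I} X i : rename.
Arguments copair {C} c {I X T} f : rename.

(** The canonical comparison maps from the coproduct of the tensor products to
    the tensor product with the coproduct are invertible. *)
Record distmon := DistMon {
  dm_mon :> symmon;
  dm_cop : coproducts dm_mon;
  dm_distr : forall (I : small) (X : I -> dm_mon) (B : dm_mon),
    invertible (copair dm_cop (fun i => inj dm_cop X i ⊠ idm B)
      : hom (coprod dm_cop (fun i => X i ⊗ B)) (coprod dm_cop X ⊗ B));
  dm_distl : forall (I : small) (X : I -> dm_mon) (B : dm_mon),
    invertible (copair dm_cop (fun i => idm B ⊠ inj dm_cop X i)
      : hom (coprod dm_cop (fun i => B ⊗ X i)) (B ⊗ coprod dm_cop X))
}.

Section Coproducts.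
Context (V : distmon).
Local Notation cop := (dm_cop V).

(** [u] is a coproduct cocone. *)
Definition is_coprod (I : small) (X : I -> V) (P : V)
    (u : forall i, hom (X i) P) : Prop :=
  forall (T : V) (f : forall i, hom (X i) T),
    exists! h : hom P T, forall i, u i >>> h = f i.

Lemma coprodP (I : small) (X : I -> V) : is_coprod (inj cop X).
Proof.
move=> T f; exists (copair cop f); split; first exact: copair_inj.
by move=> h E; apply: copair_uniq => i; rewrite copair_inj E.
Qed.

Section Cocone.
Context (I : small) (X : I -> V) (P : V) (u : forall i, hom (X i) P).

Definition desc (H : is_coprod u) (T : V) (f : forall i, hom (X i) T) :
  hom P T := proj1_sig (constructive_indefinite_description _ (H T f)).

Lemma descE (H : is_coprod u) (T : V) (f : forall i, hom (X i) T) i :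
  u i >>> desc H f = f i.
Proof.
by rewrite /desc; case: constructive_indefinite_description => h [/= -> _].
Qed.

Lemma coprod_epi (H : is_coprod u) (T : V) (f g : hom P T) :
  (forall i, u i >>> f = u i >>> g) -> f = g.
Proof.
move=> E; have [h [_ K]] := H T (fun i => u i >>> f).
by rewrite -(K f) // -(K g).
Qed.

Lemma is_coprod_iso (H : is_coprod u) (Q : V) (k : hom P Q) :
  invertible k -> is_coprod (fun i => u i >>> k).
Proof.
move=> [k' [K K']] T f; exists (k' >>> desc H f); split.
  by move=> i; rewrite cmpA -(cmpA _ k) K cmp_idr descE.
move=> h E; have -> : desc H f = k >>> h.
  by apply: (coprod_epi H) => i; rewrite descE cmpA E.
by rewrite cmpA K' cmp_idl.
Qed.

Lemma copair_invertible (H : is_coprod u) : invertible (copair cop u).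
Proof.
exists (desc H (inj cop X)); split.
  by apply: copair_uniq => i; rewrite cmpA copair_inj descE cmp_idr.
by apply: (coprod_epi H) => i; rewrite cmpA descE copair_inj cmp_idr.
Qed.

End Cocone.

Lemma is_coprod_eq (I : small) (X : I -> V) (P : V)
    (u u' : forall i, hom (X i) P) :
  (forall i, u i = u' i) -> is_coprod u -> is_coprod u'.
Proof. by move=> E; rewrite (functional_extensionality_dep u u' E). Qed.

Lemma tens_cmpl (x x' x'' y : V) (f : hom x x') (g : hom x' x'') :
  (f >>> g) ⊠ idm y = (f ⊠ idm y) >>> (g ⊠ idm y).
Proof. by rewrite -tensh_cmp cmp_idl. Qed.

Lemma tens_cmpr (x x' x'' y : V) (f : hom x x') (g : hom x' x'') :
  idm y ⊠ (f >>> g) = (idm y ⊠ f) >>> (idm y ⊠ g).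
Proof. by rewrite -tensh_cmp cmp_idl. Qed.

Lemma invertible_tens (x x' y y' : V) (f : hom x x') (g : hom y y') :
  invertible f -> invertible g -> invertible (f ⊠ g).
Proof.
move=> [f' [F F']] [g' [G G']]; exists (f' ⊠ g').
by split; rewrite -tensh_cmp ?F ?G ?F' ?G' tensh_id.
Qed.

Lemma invertible_id (x : V) : invertible (idm x).
Proof. by exists (idm x); split; exact: cmp_idl. Qed.

Lemma is_coprod_tensr (I : small) (X : I -> V) (P : V)
    (u : forall i, hom (X i) P) (B : V) :
  is_coprod u -> is_coprod (fun i => u i ⊠ idm B).
Proof.
move=> H; have K := invertible_tens (copair_invertible H) (invertible_id B).
have := is_coprod_iso (is_coprod_iso (@coprodP _ _) (dm_distr X B)) K.
by apply: is_coprod_eq => i; rewrite copair_inj -tens_cmpl copair_inj.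
Qed.

Lemma is_coprod_tensl (I : small) (X : I -> V) (P : V)
    (u : forall i, hom (X i) P) (B : V) :
  is_coprod u -> is_coprod (fun i => idm B ⊠ u i).
Proof.
move=> H; have K := invertible_tens (invertible_id B) (copair_invertible H).
have := is_coprod_iso (is_coprod_iso (@coprodP _ _) (dm_distl X B)) K.
by apply: is_coprod_eq => i; rewrite copair_inj -tens_cmpr copair_inj.
Qed.

End Coproducts.

Arguments is_coprod_tensr {V I X P u} B H.
Arguments is_coprod_tensl {V I X P u} B H.

Section Matrices.
Context (V : distmon).
Local Notation cop := (dm_cop V).

Definition set_cat : category :=
  @Category small (fun X Y => X -> Y) (fun X x => x)
    (fun X Y Z f g x => g (f x))
    (fun X Y f => eq_refl) (fun X Y f => eq_refl)
    (fun X Y Z W f g h => eq_refl).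

Definition mat (X Y : small) := X -> Y -> V.

Definition mat_over (X Y W Z : small) (M : mat X Y) (N : mat W Z)
    (f : X -> W) (g : Y -> Z) :=
  forall x y, hom (M x y) (N (f x) (g y)).

Definition mat_cell (X Y W Z : small) (M : mat X Y) (N : mat W Z) :=
  sided (mat_over M N).

Lemma mat_over_eq (X Y W Z : small) (M : mat X Y) (N : mat W Z) f g
    (a b : mat_over M N f g) :
  (forall x y, a x y = b x y) -> Sided a = Sided b.
Proof.
move=> E; have -> // : a = b.
apply: functional_extensionality_dep => x.
by apply: functional_extensionality_dep => y; exact: E.
Qed.

Definition mat_odot (X Y Z : small) (M : mat X Y) (N : mat Y Z) : mat X Z :=
  fun x z => coprod cop (fun y => M x y ⊗ N y z).

Definition initial : V :=
  coprod cop (fun e : Empty_set => match e with end).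

Definition mat_unit (X : small) : mat X X := fun x y =>
  match excluded_middle_informative (x = y) with
  | left _ => munit
  | right _ => initial
  end.

(** The entry of the identity matrix at (x, y) is a coproduct of copies of the
    monoidal unit indexed by the proofs of [x = y]; its maps out are defined
    through this universal property. *)
Definition mat_unit_inj (X : small) (x y : X) (e : x = y) :
  hom munit (mat_unit x y).
Proof.
rewrite /mat_unit; case: excluded_middle_informative => [_|n].
- exact: idm.
- case: (n e).
Defined.

Lemma mat_unitP (X : small) (x y : X) :
  is_coprod (fun e : x = y => mat_unit_inj e).
Proof.
rewrite /mat_unit_inj /mat_unit; case: excluded_middle_informative => [e|n] T f.
- exists (f e); split => [e'|h E]; last by rewrite -(E e) cmp_idl.
  by rewrite cmp_idl (proof_irrelevance _ e e').
- have [h [_ K]] := coprodP (V := V)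
    (X := fun e : Empty_set => match e with end) (T := T)
    (fun e => match e with end).
  exists h; split => [e|h' _]; first by case: (n e).
  by apply: K => -[].
Qed.

Definition mat_hcmp_over (X Y Z X' Y' Z' : small)
    (M : mat X Y) (N : mat Y Z) (M' : mat X' Y') (N' : mat Y' Z') f g h
    (a : mat_over M M' f g) (b : mat_over N N' g h) :
    mat_over (mat_odot M N) (mat_odot M' N') f h :=
  fun x z => copair cop (fun y => (a x y ⊠ b y z) >>>
    inj cop (fun y' => M' (f x) y' ⊗ N' y' (h z)) (g y)).

(** [mat_assoc], [mat_lun] and [mat_run] are the unique families induced by the
    associator and the unitors of V on the summands. *)
Definition mat_assoc (X Y Z W : small) (M : mat X Y) (N : mat Y Z)
    (P : mat Z W) : mat_over (mat_odot (mat_odot M N) P)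
      (mat_odot M (mat_odot N P)) (fun x => x) (fun w => w) :=
  fun x w => copair cop (fun z =>
    desc (is_coprod_tensr (P z w) (@coprodP V Y (fun y => M x y ⊗ N y z)))
      (fun y => massoc (M x y) (N y z) (P z w)
        >>> (idm (M x y) ⊠ inj cop (fun z => N y z ⊗ P z w) z)
        >>> inj cop (fun y => M x y ⊗ mat_odot N P y w) y)).

Definition mat_cast_l (X Y : small) (M : mat X Y) x x' y (e : x = x') :
    hom (M x' y) (M x y) :=
  match e with eq_refl => idm (M x y) end.

Definition mat_cast_r (X Y : small) (M : mat X Y) x y y' (e : y = y') :
    hom (M x y) (M x y') :=
  match e with eq_refl => idm (M x y) end.

Definition mat_lun (X Y : small) (M : mat X Y) :
    mat_over (mat_odot (@mat_unit X) M) M (fun x => x) (fun y => y) :=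
  fun x y => copair cop (fun x' =>
    desc (is_coprod_tensr (M x' y) (@mat_unitP X x x'))
      (fun e => mlun (M x' y) >>> mat_cast_l M y e)).

Definition mat_run (X Y : small) (M : mat X Y) :
    mat_over (mat_odot M (@mat_unit Y)) M (fun x => x) (fun y => y) :=
  fun x y => copair cop (fun y' =>
    desc (is_coprod_tensl (M x y') (@mat_unitP Y y' y))
      (fun e => mrun (M x y') >>> mat_cast_r M x e)).

Definition mat_cunit_over (X Y : small) (f : X -> Y) :
    mat_over (@mat_unit X) (@mat_unit Y) f f :=
  fun x y => desc (@mat_unitP X x y) (fun e => mat_unit_inj (f_equal f e)).

Definition mat_data : dbldata :=
  @DblData set_cat mat mat_cell
    (fun X Y W Z M N a => sd_l a) (fun X Y W Z M N a => sd_r a)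
    (fun X Y M => @Sided _ _ (mat_over M M) (fun x => x) (fun y => y)
      (fun x y => idm (M x y)))
    (fun X Y W Z U T M N P a b => @Sided _ _ (mat_over M P)
      (fun x => sd_l b (sd_l a x)) (fun y => sd_r b (sd_r a y))
      (fun x y => sd_in a x y >>> sd_in b (sd_l a x) (sd_r a y)))
    mat_odot
    (fun X Y Z X' Y' Z' M N M' N' a b e =>
      Sided (mat_hcmp_over (sd_in a) (cast_l e (sd_in b))))
    mat_unit
    (fun X Y f => Sided (mat_cunit_over f))
    (fun X Y Z W M N P => Sided (mat_assoc M N P))
    (fun X Y M => Sided (mat_lun M))
    (fun X Y M => Sided (mat_run M)).

Lemma mat_assocE (X Y Z W : small) (M : mat X Y) (N : mat Y Z) (P : mat Z W)
    x y z w :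
  (inj cop (fun y => M x y ⊗ N y z) y ⊠ idm (P z w)) >>>
    (inj cop (fun z => mat_odot M N x z ⊗ P z w) z >>> mat_assoc M N P x w) =
  massoc (M x y) (N y z) (P z w) >>>
    ((idm (M x y) ⊠ inj cop (fun z => N y z ⊗ P z w) z) >>>
     inj cop (fun y => M x y ⊗ mat_odot N P y w) y).
Proof.
by rewrite /mat_assoc copair_inj
  (descE (is_coprod_tensr _ (@coprodP V Y (fun y => M x y ⊗ N y z)))) cmpA.
Qed.

Lemma mat_lunE (X Y : small) (M : mat X Y) x x' y (e : x = x') :
  (mat_unit_inj e ⊠ idm (M x' y)) >>>
    (inj cop (fun x' => mat_unit x x' ⊗ M x' y) x' >>> mat_lun M x y) =
  mlun (M x' y) >>> mat_cast_l M y e.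
Proof.
by rewrite /mat_lun copair_inj
  (descE (is_coprod_tensr (M x' y) (@mat_unitP X x x'))).
Qed.

Lemma mat_runE (X Y : small) (M : mat X Y) x y y' (e : y' = y) :
  (idm (M x y') ⊠ mat_unit_inj e) >>>
    (inj cop (fun y' => M x y' ⊗ mat_unit y' y) y' >>> mat_run M x y) =
  mrun (M x y') >>> mat_cast_r M x e.
Proof.
by rewrite /mat_run copair_inj
  (descE (is_coprod_tensl (M x y') (@mat_unitP Y y' y))).
Qed.

Lemma mat_hcmpE (X Y Z X' Y' Z' : small)
    (M : mat X Y) (N : mat Y Z) (M' : mat X' Y') (N' : mat Y' Z') f g h
    (a : mat_over M M' f g) (b : mat_over N N' g h) x y z :
  inj cop (fun y => M x y ⊗ N y z) y >>> mat_hcmp_over a b x z =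
  (a x y ⊠ b y z) >>> inj cop (fun y' => M' (f x) y' ⊗ N' y' (h z)) (g y).
Proof. by rewrite /mat_hcmp_over copair_inj. Qed.

Lemma mat_cunitE (X Y : small) (f : X -> Y) x y (e : x = y) :
  mat_unit_inj e >>> mat_cunit_over f x y = mat_unit_inj (f_equal f e).
Proof. by rewrite /mat_cunit_over (descE (@mat_unitP X x y)). Qed.

Lemma mat_cell_invertible (X Y : small) (M N : mat X Y)
    (a : mat_over M N (fun x => x) (fun y => y)) :
  (forall x y, invertible (a x y)) ->
  @cell_invertible mat_data _ _ _ _ M N (Sided a).
Proof.
move=> inv.
pose b x y := proj1_sig (constructive_indefinite_description _ (inv x y)).
have bP x y : inverse_homs (a x y) (b x y).
  by rewrite /b; case: constructive_indefinite_description.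
exists (@Sided _ _ (mat_over N M) (fun x => x) (fun y => y) b).
by split; apply: mat_over_eq => x y; [exact: (proj1 (bP x y))
                                     |exact: (proj2 (bP x y))].
Qed.

Lemma cmp_at (C : category) (x y z w : C) (f : hom x y) (g : hom y z)
    (h : hom x z) (k : hom z w) : f >>> g = h -> f >>> (g >>> k) = h >>> k.
Proof. by move=> <-; rewrite cmpA. Qed.

Lemma cmp_at3 (C : category) (x y z t w : C) (f : hom x y) (g : hom y z)
    (l : hom z t) (h : hom x t) (k : hom t w) :
  f >>> (g >>> l) = h -> f >>> (g >>> (l >>> k)) = h >>> k.
Proof. by move=> <-; rewrite !cmpA. Qed.

Lemma mat_assoc_inv (X Y Z W : small) (M : mat X Y) (N : mat Y Z) (P : mat Z W)
    x w : invertible (mat_assoc M N P x w).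
Proof.
pose ai y z := constructive_indefinite_description _
  (massoc_inv (M x y) (N y z) (P z w)).
pose b : hom (mat_odot M (mat_odot N P) x w) (mat_odot (mat_odot M N) P x w) :=
  copair cop (fun y =>
    desc (is_coprod_tensl (M x y) (@coprodP V Z (fun z => N y z ⊗ P z w)))
      (fun z => proj1_sig (ai y z)
        >>> (inj cop (fun y => M x y ⊗ N y z) y ⊠ idm (P z w))
        >>> inj cop (fun z => mat_odot M N x z ⊗ P z w) z)).
have bE y z : (idm (M x y) ⊠ inj cop (fun z => N y z ⊗ P z w) z) >>>
    (inj cop (fun y => M x y ⊗ mat_odot N P y w) y >>> b) =
  proj1_sig (ai y z) >>> (
    (inj cop (fun y => M x y ⊗ N y z) y ⊠ idm (P z w))
        >>> inj cop (fun z => mat_odot M N x z ⊗ P z w) z).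
  by rewrite /b copair_inj (descE (is_coprod_tensl (M x y)
    (@coprodP V Z (fun z => N y z ⊗ P z w)))) cmpA.
exists b; split.
- apply: copair_uniq => z.
  apply: (coprod_epi (is_coprod_tensr (P z w)
    (@coprodP V Y (fun y => M x y ⊗ N y z)))) => y.
  rewrite cmp_idr -?cmpA (cmpA (inj _ _ z)) (cmp_at _ (mat_assocE _ _ _ _ _ _ _)).
  rewrite -!cmpA bE.
  by have [K _] := proj2_sig (ai y z); rewrite (cmp_at _ K) cmp_idl.
- apply: copair_uniq => y.
  apply: (coprod_epi (is_coprod_tensl (M x y)
    (@coprodP V Z (fun z => N y z ⊗ P z w)))) => z.
  rewrite cmp_idr -?cmpA (cmpA (inj _ _ y)) (cmp_at _ (bE _ _)).
  rewrite -!cmpA mat_assocE.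
  by have [_ K] := proj2_sig (ai y z); rewrite (cmp_at _ K) cmp_idl.
Qed.

Lemma mat_lun_inv (X Y : small) (M : mat X Y) x y :
  invertible (mat_lun M x y).
Proof.
have [k [K K']] := mlun_inv (M x y).
exists (k >>> ((mat_unit_inj (eq_refl x) ⊠ idm (M x y)) >>>
  inj cop (fun x' => mat_unit x x' ⊗ M x' y) x)); split.
- apply: copair_uniq => x'.
  apply: (coprod_epi (is_coprod_tensr (M x' y) (@mat_unitP X x x'))) => e.
  rewrite cmp_idr (cmpA (inj _ _ x')) (cmp_at _ (mat_lunE _ _ _)).
  destruct e; rewrite /= cmp_idr.
  by rewrite (cmp_at _ K) cmp_idl.
- rewrite -!cmpA mat_lunE /= cmp_idr; exact: K'.
Qed.

Lemma mat_run_inv (X Y : small) (M : mat X Y) x y :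
  invertible (mat_run M x y).
Proof.
have [k [K K']] := mrun_inv (M x y).
exists (k >>> ((idm (M x y) ⊠ mat_unit_inj (eq_refl y)) >>>
  inj cop (fun y' => M x y' ⊗ mat_unit y' y) y)); split.
- apply: copair_uniq => y'.
  apply: (coprod_epi (is_coprod_tensl (M x y') (@mat_unitP Y y' y))) => e.
  rewrite cmp_idr (cmpA (inj _ _ y')) (cmp_at _ (mat_runE _ _ _)).
  destruct e; rewrite /= cmp_idr.
  by rewrite (cmp_at _ K) cmp_idl.
- rewrite -!cmpA mat_runE /= cmp_idr; exact: K'.
Qed.

Lemma mat_assoc_nat (X Y Z W X' Y' Z' W' : small)
    (M : mat X Y) (N : mat Y Z) (P : mat Z W)
    (M' : mat X' Y') (N' : mat Y' Z') (P' : mat Z' W') f g h k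
    (a : mat_over M M' f g) (b : mat_over N N' g h) (c : mat_over P P' h k) x w :
  mat_hcmp_over (mat_hcmp_over a b) c x w >>> mat_assoc M' N' P' (f x) (k w) =
  mat_assoc M N P x w >>> mat_hcmp_over a (mat_hcmp_over b c) x w.
Proof.
apply: copair_uniq => z.
apply: (coprod_epi (is_coprod_tensr (P z w)
    (@coprodP V Y (fun y => M x y ⊗ N y z)))) => y.
rewrite (cmpA (inj _ _ z) (mat_assoc M N P x w)).
rewrite (cmp_at _ (mat_assocE _ _ _ _ _ _ _)) -!cmpA mat_hcmpE.
rewrite (cmp_at _ (mat_hcmpE _ _ _ _ _)) -!cmpA.
have E1 : (inj cop (fun y => M x y ⊗ N y z) y ⊠ idm (P z w)) >>>
    (mat_hcmp_over a b x z ⊠ c z w) =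
  ((a x y ⊠ b y z) ⊠ c z w) >>>
    (inj cop (fun y' => M' (f x) y' ⊗ N' y' (h z)) (g y) ⊠ idm _).
  by rewrite -!tensh_cmp mat_hcmpE cmp_idl cmp_idr.
have E2 : (idm (M x y) ⊠ inj cop (fun z => N y z ⊗ P z w) z) >>>
    (a x y ⊠ mat_hcmp_over b c y w) =
  (a x y ⊠ (b y z ⊠ c z w)) >>>
    (idm _ ⊠ inj cop (fun z' => N' (g y) z' ⊗ P' z' (k w)) (h z)).
  by rewrite -!tensh_cmp mat_hcmpE cmp_idl cmp_idr.
rewrite (cmp_at _ E1) (cmp_at _ E2) -!cmpA mat_assocE.
by rewrite (cmp_at _ (massoc_nat _ _ _)) -!cmpA.
Qed.

Lemma mat_lun_nat (X Y X' Y' : small) (M : mat X Y) (M' : mat X' Y') f g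
    (a : mat_over M M' f g) x y :
  mat_hcmp_over (mat_cunit_over f) a x y >>> mat_lun M' (f x) (g y) =
  mat_lun M x y >>> a x y.
Proof.
apply: copair_uniq => x'.
apply: (coprod_epi (is_coprod_tensr (M x' y) (@mat_unitP X x x'))) => e.
rewrite (cmpA (inj _ _ x') (mat_lun M x y)).
rewrite (cmp_at _ (mat_lunE _ _ _)) (cmp_at _ (mat_hcmpE _ _ _ _ _)) -!cmpA.
have E : (mat_unit_inj e ⊠ idm (M x' y)) >>> (mat_cunit_over f x x' ⊠ a x' y) =
    (idm munit ⊠ a x' y) >>> (mat_unit_inj (f_equal f e) ⊠ idm _).
  by rewrite -!tensh_cmp mat_cunitE !cmp_idl cmp_idr.
rewrite (cmp_at _ E) -!cmpA mat_lunE (cmp_at _ (mlun_nat _)) -!cmpA.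
by destruct e; rewrite /= cmp_idl cmp_idr.
Qed.

Lemma mat_run_nat (X Y X' Y' : small) (M : mat X Y) (M' : mat X' Y') f g
    (a : mat_over M M' f g) x y :
  mat_hcmp_over a (mat_cunit_over g) x y >>> mat_run M' (f x) (g y) =
  mat_run M x y >>> a x y.
Proof.
apply: copair_uniq => y'.
apply: (coprod_epi (is_coprod_tensl (M x y') (@mat_unitP Y y' y))) => e.
rewrite (cmpA (inj _ _ y') (mat_run M x y)).
rewrite (cmp_at _ (mat_runE _ _ _)) (cmp_at _ (mat_hcmpE _ _ _ _ _)) -!cmpA.
have E : (idm (M x y') ⊠ mat_unit_inj e) >>> (a x y' ⊠ mat_cunit_over g y' y) =
    (a x y' ⊠ idm munit) >>> (idm _ ⊠ mat_unit_inj (f_equal g e)).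
  by rewrite -!tensh_cmp mat_cunitE !cmp_idl cmp_idr.
rewrite (cmp_at _ E) -!cmpA mat_runE (cmp_at _ (mrun_nat _)) -!cmpA.
by destruct e; rewrite /= cmp_idl cmp_idr.
Qed.

Lemma mat_triangle (X Y Z : small) (M : mat X Y) (N : mat Y Z) x z :
  mat_assoc M (@mat_unit Y) N x z >>>
    mat_hcmp_over (fun x y => idm (M x y)) (mat_lun N) x z =
  mat_hcmp_over (mat_run M) (fun y z => idm (N y z)) x z.
Proof.
apply: copair_uniq => y'.
apply: (coprod_epi (is_coprod_tensr (N y' z)
    (@coprodP V Y (fun y => M x y ⊗ mat_unit y y')))) => y.
apply: (coprod_epi (is_coprod_tensr (N y' z)
  (is_coprod_tensl (M x y) (@mat_unitP Y y y')))) => e.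
rewrite (cmpA (inj _ _ y')) (cmp_at _ (mat_assocE _ _ _ _ _ _ _)) -!cmpA.
rewrite !mat_hcmpE.
rewrite (cmp_at _ (massoc_nat _ _ _)) -!cmpA.
have E1 : (idm (M x y) ⊠ (mat_unit_inj e ⊠ idm (N y' z))) >>>
    ((idm (M x y) ⊠ inj cop (fun y' => mat_unit y y' ⊗ N y' z) y') >>>
     (idm (M x y) ⊠ mat_lun N y z)) =
    (idm (M x y) ⊠ mlun (N y' z)) >>> (idm (M x y) ⊠ mat_cast_l N z e).
  by rewrite -!tensh_cmp !cmp_idl mat_lunE.
have E2 : ((idm (M x y) ⊠ mat_unit_inj e) ⊠ idm (N y' z)) >>>
    ((inj cop (fun y => M x y ⊗ mat_unit y y') y ⊠ idm (N y' z)) >>>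
     (mat_run M x y' ⊠ idm (N y' z))) =
    (mrun (M x y) ⊠ idm (N y' z)) >>> (mat_cast_r M x e ⊠ idm (N y' z)).
  by rewrite -!tensh_cmp !cmp_idl mat_runE.
rewrite (cmp_at3 _ E1) (cmp_at3 _ E2) -!cmpA.
destruct e; rewrite /= !tensh_id !cmp_idl cmpA.
by rewrite mtriangle.
Qed.

Lemma mat_pentagon (X Y Z W U : small) (M : mat X Y) (N : mat Y Z)
    (P : mat Z W) (Q : mat W U) x u :
  mat_hcmp_over (mat_assoc M N P) (fun w u => idm (Q w u)) x u >>>
    mat_assoc M (mat_odot N P) Q x u >>>
    mat_hcmp_over (fun x y => idm (M x y)) (mat_assoc N P Q) x u =
  mat_assoc (mat_odot M N) P Q x u >>> mat_assoc M N (mat_odot P Q) x u.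
Proof.
apply: copair_uniq => w.
apply: (coprod_epi (is_coprod_tensr (Q w u)
    (@coprodP V Z (fun z => mat_odot M N x z ⊗ P z w)))) => z.
apply: (coprod_epi (is_coprod_tensr (Q w u) (is_coprod_tensr (P z w)
    (@coprodP V Y (fun y => M x y ⊗ N y z))))) => y.
pose iMN := inj cop (fun y => M x y ⊗ N y z) y.
pose iPQ := inj cop (fun w => P z w ⊗ Q w u) w.
pose iNP := inj cop (fun z => N y z ⊗ P z w) z.
have A1 := mat_assocE M N P x y z w.
have A2 := mat_assocE M (mat_odot N P) Q x y w u.
have A3 := mat_assocE (mat_odot M N) P Q x z w u.
have A4 := mat_assocE M N (mat_odot P Q) x y z u.
have A5 := mat_assocE N P Q y z w u.
have E1 : ((iMN ⊠ idm (P z w)) ⊠ idm (Q w u)) >>>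
  ((inj cop (fun z => mat_odot M N x z ⊗ P z w) z ⊠ idm (Q w u)) >>>
   (mat_assoc M N P x w ⊠ idm (Q w u))) =
  (massoc (M x y) (N y z) (P z w) ⊠ idm (Q w u)) >>>
    (((idm (M x y) ⊠ iNP) ⊠ idm (Q w u)) >>>
     (inj cop (fun y => M x y ⊗ mat_odot N P y w) y ⊠ idm (Q w u))).
  by rewrite -!tensh_cmp !cmp_idl A1.
have E5 : (idm (M x y) ⊠ (iNP ⊠ idm (Q w u))) >>>
  ((idm (M x y) ⊠ inj cop (fun w => mat_odot N P y w ⊗ Q w u) w) >>>
   (idm (M x y) ⊠ mat_assoc N P Q y u)) =
  (idm (M x y) ⊠ massoc (N y z) (P z w) (Q w u)) >>>
    ((idm (M x y) ⊠ (idm (N y z) ⊠ iPQ)) >>>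
     (idm (M x y) ⊠ inj cop (fun z => N y z ⊗ mat_odot P Q z u) z)).
  by rewrite -!tensh_cmp !cmp_idl A5.
transitivity (massoc (M x y) (N y z) (P z w) ⊠ idm (Q w u) >>>
  (massoc (M x y) (N y z ⊗ P z w) (Q w u) >>>
  ((idm (M x y) ⊠ massoc (N y z) (P z w) (Q w u)) >>>
    ((idm (M x y) ⊠ (idm (N y z) ⊠ iPQ)) >>>
     ((idm (M x y) ⊠ inj cop (fun z => N y z ⊗ mat_odot P Q z u) z) >>>
  inj cop (fun y => M x y ⊗ mat_odot N (mat_odot P Q) y u) y))))).
- rewrite -!cmpA (cmp_at _ (mat_hcmpE _ _ _ _ _)) -!cmpA.
  rewrite (cmp_at3 _ E1) -!cmpA.
  congr (_ >>> _).
  rewrite (cmpA (inj _ _ w)) (cmp_at _ A2) -!cmpA.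
  rewrite (cmp_at _ (massoc_nat _ _ _)) -!cmpA; congr (_ >>> _).
  rewrite mat_hcmpE (cmp_at3 _ E5).
  by rewrite -!cmpA.
- rewrite (cmpA (inj _ _ w)) (cmp_at _ A3) -!cmpA.
  rewrite (cmp_at _ (massoc_nat _ _ _)) -!cmpA tensh_id.
  have X1 : (iMN ⊠ idm (P z w ⊗ Q w u)) >>> (idm (mat_odot M N x z) ⊠ iPQ) =
    (idm (M x y ⊗ N y z) ⊠ iPQ) >>> (iMN ⊠ idm (mat_odot P Q z u)).
    by rewrite -!tensh_cmp !cmp_idl !cmp_idr.
  rewrite (cmp_at _ X1) -!cmpA A4 -tensh_id (cmp_at _ (massoc_nat _ _ _)).
  by rewrite !cmpA mpentagon.
Qed.

Lemma mat_laws : dbllaws mat_data.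
Proof.
split.
- by move=> *; apply: mat_over_eq => x y; exact: cmp_idl.
- by move=> *; apply: mat_over_eq => x y; exact: cmp_idr.
- by move=> *; apply: mat_over_eq => x y; exact: cmpA.
- by [].
- by [].
- by [].
- by [].
- by [].
- by [].
- move=> X Y Z M N e; rewrite (proof_irrelevance _ e eq_refl).
  apply: mat_over_eq => x z; apply: copair_uniq => y.
  by rewrite mat_hcmpE tensh_id cmp_idl cmp_idr.
- move=> X Y Z X' Y' Z' X'' Y'' Z'' M N M' N' M'' N'' [f g a] [g1 h b]
    [f' g' a'] [g1' h' b'] /= e e' e''.
  destruct e, e'; rewrite (proof_irrelevance _ e'' eq_refl).
  apply: mat_over_eq => x z; apply: copair_uniq => y.
  rewrite /= (cmp_at _ (mat_hcmpE _ _ _ _ _)) -cmpA !mat_hcmpE.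
  by rewrite tensh_cmp -cmpA.
- by [].
- by [].
- move=> X; apply: mat_over_eq => x y; apply: (coprod_epi (@mat_unitP X x y)).
  by move=> e; rewrite mat_cunitE cmp_idr; destruct e.
- move=> X Y Z f g; apply: mat_over_eq => x y.
  apply: (coprod_epi (@mat_unitP X x y)) => e.
  by rewrite mat_cunitE /= (cmp_at _ (mat_cunitE _ _)) mat_cunitE; destruct e.
- by [].
- by move=> X Y Z W M N P; apply: mat_cell_invertible; exact: mat_assoc_inv.
- move=> X Y Z W X' Y' Z' W' M N P M' N' P' [f g a] [g1 h b] [h1 k c]
    /= e1 e2 e3 e4.
  destruct e1, e2; rewrite (proof_irrelevance _ e3 eq_refl).
  rewrite (proof_irrelevance _ e4 eq_refl).
  by apply: mat_over_eq => x w; exact: mat_assoc_nat.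
- by [].
- by move=> X Y M; apply: mat_cell_invertible; exact: mat_lun_inv.
- move=> X Y X' Y' M M' [f g a] /= e; rewrite (proof_irrelevance _ e eq_refl).
  by apply: mat_over_eq => x y; exact: mat_lun_nat.
- by [].
- by move=> X Y M; apply: mat_cell_invertible; exact: mat_run_inv.
- move=> X Y X' Y' M M' [f g a] /= e; rewrite (proof_irrelevance _ e eq_refl).
  by apply: mat_over_eq => x y; exact: mat_run_nat.
- move=> X Y Z M N e e'.
  rewrite (proof_irrelevance _ e eq_refl) (proof_irrelevance _ e' eq_refl).
  by apply: mat_over_eq => x z; exact: mat_triangle.
- move=> X Y Z W U M N P Q e e'.
  rewrite (proof_irrelevance _ e eq_refl) (proof_irrelevance _ e' eq_refl).
  by apply: mat_over_eq => x z; exact: mat_pentagon.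
Qed.

End Matrices.

Definition matrices (V : distmon) : dblcat := DblCat (mat_laws V).

(* Main.v *)
From Stdlib Require Import ssreflect.
From Stdlib Require Import FunctionalExtensionality ProofIrrelevance.
Require Import Defs.

Set Implicit Arguments.
Unset Strict Implicit.
Unset Printing Implicit Defensive.
Set Primitive Projections.

(** The left adjoint [Sum] of the diagonal takes coproducts at two levels: the
    sum of a family of sets is their disjoint union, and the sum of a family of
    matrices [m] indexed by a span has at ((i, x), (j, y)) the coproduct in [V]
    of the entries of the [m_a] at (x, y), over the edges [a] from i to j.  A
    map out of such a sum is a family of maps on its summands, so every
    equation between cells out of a sum is checked after precomposition with
    the injections ([sum_epi], [odot_sum_epi], [sum_unit_epi]); there it becomes
    the corresponding equation of [V], typically the naturality of the
    associator or of a unitor.  This gives the colax laws of [Sum] and the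
    adjunction, whose unit consists of the injections and whose counit folds a
    sum indexed by a point.

    That [Sum] is pseudo comes from distributivity.  Both sides of its
    comparison cell at ((i, x), (k, z)) are coproducts of the same objects,
    the tensor products of [m_a] at (x, y) with [n_b] at (y, z), indexed by the
    y in the summand of the middle family over j and the pairs of edges
    [a] from i to j and [b] from j to k: on one side the composite of spans is
    summed over directly, on the other side the index sums stand inside the
    tensor product and distributivity takes them out ([sum_comp_inv]).  For
    units, both sides are coproducts of copies of the monoidal unit indexed by
    the proofs of (i, x) = (j, y) ([sum_unit_inv]). *)

Arguments fpro {D X Y} f {i j} a : rename.

(** * Families over a point *)

Section ConstantTargets.
Context (D : dblcat).

Lemma diag_hom_eq (X : fam D) (y : D) (f g : hom X (diag_ob y)) :
  (forall i, fh_arr f i = fh_arr g i) -> f = g.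
Proof.
case: f => f0 f; case: g => g0 g /= E.
have e : f0 = g0 by apply: functional_extensionality => i; exact: unit_eq.
by destruct e; apply: fam_hom_eq.
Qed.

(** When the target has at most one edge, over a point, the index maps of two
    cells agree automatically and only the components are left to compare.  The
    span [S] is kept general so as to cover the composite of two diagonal
    proarrows, whose span is a pullback of points. *)
Lemma const_cell_eq (X Y : fam D) (m : pro X Y) (w z : D) (S : span unit unit)
    (n : pro w z) :
  (forall b b' : apex S, b = b') ->
  forall al be : fam_cell m
    (@FamPro D (diag_ob w) (diag_ob z) S (fun _ _ _ => n)),
  sd_l al = sd_l be -> sd_r al = sd_r be ->
  (forall i j (a : edge (fspan m) i j),
    fo_cell (sd_in al) a = fo_cell (sd_in be) a :> cell (fpro m a) n) ->
  al = be.
Proof.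
move=> U al be el er E; apply: fam_cell_eq => // i j a.
rewrite /fc_target; move: (fo_cell _ _) (fo_cell _ _) (E i j a).
move: (fo_map _ _) (fo_map _ _).
rewrite (unit_eq (fh_idx (sd_l al) i) tt) (unit_eq (fh_idx (sd_l be) i) tt).
rewrite (unit_eq (fh_idx (sd_r al) j) tt) (unit_eq (fh_idx (sd_r be) j) tt).
move=> b b' c c' /= Ec.
by apply: (@const_target_eq D (diag_ob w) (diag_ob z) S (fun _ _ => n)).
Qed.

End ConstantTargets.

(** * Components of cells of matrices over prescribed sides *)

Section Sums.
Context (V : distmon).
Local Notation cop := (dm_cop V).
Local Notation Mat := (matrices V).

(** In a cell of families the sides of a component are only propositionally
    equal to the components of the sides.  This moves a component to the
    prescribed sides once and for all; by proof irrelevance it is invisible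
    whenever the sides agree by conversion ([at_sidesE]). *)
Definition at_sides (X Y W Z : small) (M : mat V X Y) (N : mat V W Z)
    (f : X -> W) (g : Y -> Z) (a : mat_cell M N) (el : sd_l a = f)
    (er : sd_r a = g) : mat_over M N f g :=
  match el in _ = f', er in _ = g' return mat_over M N f' g' with
  | eq_refl, eq_refl => sd_in a
  end.

Lemma at_sidesE (X Y W Z : small) (M : mat V X Y) (N : mat V W Z)
    (a : mat_cell M N) el er x y : at_sides (a := a) el er x y = sd_in a x y.
Proof.
by rewrite (proof_irrelevance _ el eq_refl) (proof_irrelevance _ er eq_refl).
Qed.

Lemma Sided_at_sides (X Y W Z : small) (M : mat V X Y) (N : mat V W Z)
    (f : X -> W) (g : Y -> Z) (a : mat_cell M N) (el : sd_l a = f)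
    (er : sd_r a = g) : a = Sided (at_sides el er).
Proof. by destruct el, er. Qed.

Lemma at_sides_cmp (X Y W Z U T : small) (M : mat V X Y) (N : mat V W Z)
    (P : mat V U T) f g f' g' (a : cell (d := mat_data V) M N)
    (b : cell (d := mat_data V) N P)
    (el : sd_l a = f) (er : sd_r a = g) (el' : sd_l b = f') (er' : sd_r b = g')
    el2 er2 x y :
  at_sides (a := a ** b) (f := fun x => f' (f x)) (g := fun y => g' (g y))
    el2 er2 x y =
  at_sides el er x y >>> at_sides el' er' (f x) (g y).
Proof. by destruct el, er, el', er'; rewrite (at_sidesE el2 er2). Qed.

Lemma at_sides_hcmp (X Y Z X' Y' Z' : small)
    (M : mat V X Y) (N : mat V Y Z) (M' : mat V X' Y') (N' : mat V Y' Z') f g h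
    (a : cell (d := mat_data V) M M') (b : cell (d := mat_data V) N N') e
    (el : sd_l a = f) (er : sd_r a = g) (el' : sd_l b = g) (er' : sd_r b = h)
    el2 er2 x z :
  at_sides (a := hcmp a b e) (f := f) (g := h) el2 er2 x z =
  mat_hcmp_over (at_sides el er) (at_sides el' er') x z.
Proof.
case: a b e el er el' er' el2 er2 => [f1 g1 a] [g2 h1 b] /= e el er el' er'.
destruct el, er, er', e => el2 er2.
rewrite (proof_irrelevance _ el' eq_refl) (proof_irrelevance _ el2 eq_refl).
by rewrite (proof_irrelevance _ er2 eq_refl).
Qed.

(** * Sums of families *)

(** Since the projections are primitive, a point of a disjoint union is
    convertible to the pair of its components, which makes [sum_hom] strictly
    functorial. *)
Record total (X : fam Mat) : small := Total { tidx : fidx X; tval : X tidx }.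

Definition sum_hom (X Y : fam Mat) (f : hom X Y) (p : total X) : total Y :=
  @Total Y (fh_idx f (tidx p)) (fh_arr f (tidx p) (tval p)).

Definition sum_pro (X Y : fam Mat) (m : pro X Y) : mat V (total X) (total Y) :=
  fun p q => coprod cop
    (fun a : edge (fspan m) (tidx p) (tidx q) => fpro m a (tval p) (tval q)).

Definition sum_inj (X Y : fam Mat) (m : pro X Y) i j (a : edge (fspan m) i j)
    (x : X i) (y : Y j) :
    hom (fpro m a x y) (sum_pro m (@Total X i x) (@Total Y j y)) :=
  inj cop (fun a : edge (fspan m) i j => fpro m a x y) a.

Definition sum_copair (X Y : fam Mat) (m : pro X Y) i j (x : X i) (y : Y j)
    (T : V)
    (h : forall a : edge (fspan m) i j, hom (fpro m a x y) T) :
    hom (sum_pro m (@Total X i x) (@Total Y j y)) T :=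
  copair cop h.

Lemma sum_copairE (X Y : fam Mat) (m : pro X Y) i j (x : X i) (y : Y j) (T : V)
    (h : forall a : edge (fspan m) i j, hom (fpro m a x y) T) a :
  sum_inj a x y >>> sum_copair h = h a.
Proof. exact: (copair_inj cop h a). Qed.

Lemma sum_epi (X Y : fam Mat) (m : pro X Y) i j (x : X i) (y : Y j) (T : V)
    (h k : hom (sum_pro m (@Total X i x) (@Total Y j y)) T) :
  (forall a : edge (fspan m) i j, sum_inj a x y >>> h = sum_inj a x y >>> k) ->
  h = k.
Proof. exact: copair_uniq. Qed.

Definition comp_at (X Y W Z : fam Mat) (m : pro X Y) (n : pro W Z) f g
    (al : fam_over m n f g) i j (a : edge (fspan m) i j) :
    mat_over (fpro m a) (fpro n (fo_map al a)) (fh_arr f i) (fh_arr g j) :=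
  at_sides (fo_l al a) (fo_r al a).

Definition sum_cell (X Y W Z : fam Mat) (m : pro X Y) (n : pro W Z) f g
    (al : fam_over m n f g) :
    mat_over (sum_pro m) (sum_pro n) (sum_hom f) (sum_hom g) :=
  fun p q => sum_copair (x := tval p) (y := tval q)
    (fun a => comp_at al a (tval p) (tval q) >>> sum_inj (fo_map al a) _ _).

Lemma sum_cellE (X Y W Z : fam Mat) (m : pro X Y) (n : pro W Z) f g
    (al : fam_over m n f g) i j (a : edge (fspan m) i j) x y :
  sum_inj a x y >>> sum_cell al (@Total X i x) (@Total Y j y) =
  comp_at al a x y >>> sum_inj (fo_map al a) _ _.
Proof. exact: sum_copairE. Qed.

Local Notation oinj M N p q r := (inj cop (fun q' => M p q' ⊗ N q' r) q).

Definition sum_comp (X Y Z : fam Mat) (m : pro X Y) (n : pro Y Z) :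
    mat_over (sum_pro (m ⊙ n)) (mat_odot (sum_pro m) (sum_pro n))
      (fun p => p) (fun r => r) :=
  fun p r => sum_copair (m := m ⊙ n) (x := tval p) (y := tval r)
    (fun c => copair cop (fun y : Y (mid c) =>
      (sum_inj (ledge c) (tval p) y ⊠ sum_inj (redge c) y (tval r)) >>>
      oinj (sum_pro m) (sum_pro n) p (@Total Y (mid c) y) r)).

Lemma sum_compE (X Y Z : fam Mat) (m : pro X Y) (n : pro Y Z) i j k
    (a : edge (fspan m) i j) (b : edge (fspan n) j k) x y z :
  oinj (fpro m a) (fpro n b) x y z >>>
    (sum_inj (m := m ⊙ n) (pair_edge a b) x z >>>
      sum_comp m n (@Total X i x) (@Total Z k z)) =
  (sum_inj a x y ⊠ sum_inj b y z) >>>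
    oinj (sum_pro m) (sum_pro n) (@Total X i x) (@Total Y j y) (@Total Z k z).
Proof. by rewrite sum_copairE copair_inj. Qed.

(** An edge of the identity span is an equality of indices; once the indices are
    identified, the inclusion of one set of the family in the disjoint union
    induces a map of identity matrices. *)
Definition unit_entry (X : fam Mat) i j (a : edge (span_id (fidx X)) i j) :
    forall x y, hom (fam_unit_pro a x y)
      (mat_unit V (@Total X i x) (@Total X j y)).
Proof.
case: a => i0 e1 e2 /=; case: _ / e1; case: _ / e2 => x y.
exact: (mat_cunit_over V (@Total X i0) x y).
Defined.

Definition refl_edge (I : small) (i : I) : edge (span_id I) i i :=
  @Edge I I (span_id I) i i i eq_refl eq_refl.

Definition sum_unit (X : fam Mat) :
    mat_over (sum_pro (punit X)) (@mat_unit V (total X))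
      (fun p => p) (fun q => q) :=
  fun p q => sum_copair (m := punit X) (x := tval p) (y := tval q)
    (fun a => unit_entry a (tval p) (tval q)).

Lemma sum_unit_refl (X : fam Mat) (i : fidx X) (x : X i) :
  mat_unit_inj V (eq_refl x) >>>
    (sum_inj (m := punit X) (refl_edge i) x x
      >>> sum_unit (@Total X i x) (@Total X i x)) =
  mat_unit_inj V (eq_refl (@Total X i x)).
Proof.
rewrite (sum_copairE (m := punit X) _ (refl_edge i)).
exact: (mat_cunitE V (@Total X i) eq_refl).
Qed.

(** The injections that exhibit an entry of the sum of the identity matrices as
    a coproduct of copies of the monoidal unit indexed by [p = q], exactly as
    for an entry of the identity matrix of the disjoint union. *)
Definition sum_unit_inj (X : fam Mat) (p q : total X) (e : p = q) :
    hom munit (sum_pro (punit X) p q) :=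
  match e with
  | eq_refl => mat_unit_inj V (eq_refl (tval p)) >>>
      sum_inj (m := punit X) (refl_edge (tidx p)) (tval p) (tval p)
  end.

Lemma sum_unitE (X : fam Mat) (p q : total X) (e : p = q) :
  sum_unit_inj e >>> sum_unit p q = mat_unit_inj V e.
Proof.
by destruct e; case: p => i x; rewrite -cmpA; exact: sum_unit_refl.
Qed.

Lemma sum_unit_epi (X : fam Mat) (p q : total X) (T : V)
    (h k : hom (sum_pro (punit X) p q) T) :
  (forall e : p = q, sum_unit_inj e >>> h = sum_unit_inj e >>> k) -> h = k.
Proof.
case: p h k => i x; case: q => j y h k E.
apply: sum_epi => -[i0 e1 e2].
destruct e1, e2.
apply: (coprod_epi (@mat_unitP V _ x y)) => e; destruct e.
by have := E eq_refl; rewrite /= -!cmpA.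
Qed.

Lemma sum_unit_inv (X : fam Mat) (p q : total X) : invertible (sum_unit p q).
Proof.
exists (desc (@mat_unitP V _ p q) (fun e => sum_unit_inj e)); split.
- apply: sum_unit_epi => e.
  by rewrite (cmp_at _ (sum_unitE e)) descE cmp_idr.
- apply: (coprod_epi (@mat_unitP V _ p q)) => e.
  by rewrite cmpA descE sum_unitE cmp_idr.
Qed.

Lemma odot_sum_epi (X Y Z : fam Mat) (m : pro X Y) (n : pro Y Z) i k
    (x : X i) (z : Z k) (T : V)
    (h h' : hom (sum_pro (m ⊙ n) (@Total X i x) (@Total Z k z)) T) :
  (forall j (a : edge (fspan m) i j) (b : edge (fspan n) j k) y,
    oinj (fpro m a) (fpro n b) x y z >>>
      (sum_inj (m := m ⊙ n) (pair_edge a b) x z >>> h) =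
    oinj (fpro m a) (fpro n b) x y z >>>
      (sum_inj (m := m ⊙ n) (pair_edge a b) x z >>> h')) ->
  h = h'.
Proof.
move=> E; apply: sum_epi; apply: cmp_edge_ind => j a b.
by apply: copair_uniq => y; exact: E.
Qed.

Lemma sum_pro_coprod (X Y : fam Mat) (m : pro X Y) i j (x : X i) (y : Y j) :
  is_coprod (fun a : edge (fspan m) i j => sum_inj a x y).
Proof. exact: coprodP. Qed.
Arguments sum_pro_coprod {X Y} m {i j} x y.

(** The inverse is defined on the summands of the matrix product of the sums.
    These are reached because tensoring with an object on either side preserves
    the coproduct cocones of [sum_pro_coprod], by distributivity. *)
Lemma sum_comp_inv (X Y Z : fam Mat) (m : pro X Y) (n : pro Y Z) p r :
  invertible (sum_comp m n p r).
Proof.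
case: p => i x; case: r => k z.
pose d j y a := desc (is_coprod_tensl (fpro m a x y) (sum_pro_coprod n y z))
  (fun b : edge (fspan n) j k => oinj (fpro m a) (fpro n b) x y z >>>
      sum_inj (m := m ⊙ n) (pair_edge a b) x z).
pose g : hom (mat_odot (sum_pro m) (sum_pro n) (@Total X i x) (@Total Z k z))
    (sum_pro (m ⊙ n) (@Total X i x) (@Total Z k z)) :=
  copair cop (fun q : total Y => desc (is_coprod_tensr
    (sum_pro n q (@Total Z k z)) (sum_pro_coprod m x (tval q)))
    (d (tidx q) (tval q))).
have gE j y a b : (sum_inj a x y ⊠ sum_inj b y z) >>>
    (oinj (sum_pro m) (sum_pro n) (@Total X i x) (@Total Y j y) (@Total Z k z)
      >>> g) =
  oinj (fpro m a) (fpro n b) x y z >>>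
      sum_inj (m := m ⊙ n) (pair_edge a b) x z.
  rewrite /g copair_inj -(cmp_idl (sum_inj a x y)) -(cmp_idr (sum_inj b y z)).
  by rewrite tensh_cmp -cmpA (descE (is_coprod_tensr _ (sum_pro_coprod m x y)))
    (descE (is_coprod_tensl _ (sum_pro_coprod n y z))).
exists g; split.
- apply: odot_sum_epi => j a b y.
  by rewrite cmp_idr (cmpA (sum_inj _ _ _)) (cmp_at _ (sum_compE _ _ _ _ _))
    -cmpA gE.
- apply: copair_uniq => -[j y].
  apply: (coprod_epi (is_coprod_tensr _ (sum_pro_coprod m x y))) => a.
  apply: (coprod_epi (is_coprod_tensl _ (sum_pro_coprod n y z))) => b.
  have T : (idm (fpro m a x y) ⊠ sum_inj b y z) >>>
    (sum_inj a x y ⊠ idm (sum_pro n (@Total Y j y) (@Total Z k z))) =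
    sum_inj a x y ⊠ sum_inj b y z by rewrite -tensh_cmp cmp_idl cmp_idr.
  rewrite !(cmp_at _ T) cmp_idr (cmpA (inj _ _ _)) (cmp_at _ (gE _ _ _ _)).
  by rewrite -cmpA sum_compE.
Qed.

(** * Colax coherence of the sum *)

Lemma sum_cell_id (X Y : fam Mat) (m : pro X Y) p q :
  sum_cell (sd_in (cid m)) p q = idm (sum_pro m p q).
Proof.
case: p q => i x [j y]; apply: sum_epi => a.
have E : comp_at (sd_in (cid m)) a x y = idm (fpro m a x y).
  exact: (at_sidesE (fo_l (sd_in (cid m)) a) (fo_r (sd_in (cid m)) a)).
by rewrite sum_cellE E cmp_idr; exact: cmp_idl.
Qed.

Lemma sum_cell_cmp (X Y W Z U T : fam Mat) (m : pro X Y) (n : pro W Z)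
    (r : pro U T) (al : cell m n) (be : cell n r) p q :
  sum_cell (sd_in (al ** be)) p q =
  sum_cell (sd_in al) p q >>>
    sum_cell (sd_in be) (sum_hom (sd_l al) p) (sum_hom (sd_r al) q).
Proof.
case: p q => i x [j y]; apply: sum_epi => a.
rewrite sum_cellE (cmp_at _ (sum_cellE _ _ _ _)) -cmpA sum_cellE cmpA.
by rewrite /comp_at (at_sides_cmp (fo_l (sd_in al) a) (fo_r (sd_in al) a)
  (fo_l (sd_in be) _) (fo_r (sd_in be) _)).
Qed.

Lemma sum_comp_nat (X Y Z X' Y' Z' : fam Mat) (m : pro X Y) (n : pro Y Z)
    (m' : pro X' Y') (n' : pro Y' Z') f g h
    (al : fam_over m m' f g) (be : fam_over n n' g h) p r :
  sum_cell (fam_hcmp_over al be) p r >>>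
    sum_comp m' n' (sum_hom f p) (sum_hom h r) =
  sum_comp m n p r >>> mat_hcmp_over (sum_cell al) (sum_cell be) p r.
Proof.
case: p r => i x [k z]; apply: odot_sum_epi => j a b y.
rewrite (cmp_at _ (sum_cellE _ _ _ _)).
rewrite /comp_at
  (at_sides_hcmp (fo_l al a) (fo_r al a) (fo_l be b) (fo_r be b)).
rewrite -!cmpA.
rewrite (cmp_at _ (mat_hcmpE _ _ _ _ _)) -cmpA sum_compE.
rewrite (cmp_at3 _ (sum_compE _ _ _ _ _)) -cmpA mat_hcmpE.
rewrite !cmpA -!tensh_cmp.
by rewrite !sum_cellE.
Qed.

Lemma sum_unit_nat (X Y : fam Mat) (f : hom X Y) p q :
  sum_cell (sd_in (cunit f)) p q >>> sum_unit (sum_hom f p) (sum_hom f q) =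
  sum_unit p q >>> mat_cunit_over V (sum_hom f) p q.
Proof.
apply: sum_unit_epi => e.
rewrite (cmp_at _ (sum_unitE e)) mat_cunitE.
have E : sum_unit_inj e >>> sum_cell (sd_in (cunit f)) p q =
    sum_unit_inj (f_equal (sum_hom f) e).
  destruct e; case: p => i x.
  rewrite -cmpA (sum_cellE (sd_in (cunit f)) (refl_edge i)) cmpA.
  congr (_ >>> _).
  rewrite /comp_at (at_sidesE (fo_l (sd_in (cunit f)) (refl_edge i))).
  exact: (mat_cunitE V (fh_arr f i) eq_refl).
by rewrite (cmp_at _ E) sum_unitE.
Qed.

(** On the summand of edges [a], [b], [c] and elements y, z, both sides are the
    associator followed by the injections; the right-hand side reaches this form
    through the naturality of the associator. *)
Lemma sum_assoc (X Y Z W : fam Mat) (m : pro X Y) (n : pro Y Z) (r : pro Z W)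
    p q :
  sum_cell (sd_in (dassoc m n r)) p q >>> sum_comp m (n ⊙ r) p q >>>
    mat_hcmp_over (fun p q => idm (sum_pro m p q)) (sum_comp n r) p q =
  sum_comp (m ⊙ n) r p q >>>
    mat_hcmp_over (sum_comp m n) (fun p q => idm (sum_pro r p q)) p q >>>
    mat_assoc (sum_pro m) (sum_pro n) (sum_pro r) p q.
Proof.
case: p q => i x [l w]; apply: odot_sum_epi => k ab c z; move: ab.
(* The inner matrix product sits under a tensor with the third entry, so its
   injections are jointly epic only by distributivity. *)
apply: cmp_edge_ind => j a b.
apply: (coprod_epi (is_coprod_tensr (fpro r c z w)
    (@coprodP V (Y j) (fun y => fpro m a x y ⊗ fpro n b y z)))) => y.
transitivity (massoc (fpro m a x y) (fpro n b y z) (fpro r c z w) >>>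
  ((sum_inj a x y ⊠ (sum_inj b y z ⊠ sum_inj c z w)) >>>
  ((idm (sum_pro m (@Total X i x) (@Total Y j y))
    ⊠ oinj (sum_pro n) (sum_pro r)
        (@Total Y j y) (@Total Z k z) (@Total W l w))
   >>> oinj (sum_pro m) (mat_odot (sum_pro n) (sum_pro r)) (@Total X i x)
         (@Total Y j y) (@Total W l w)))).
- rewrite -!cmpA.
  rewrite (cmp_at _ (sum_cellE (sd_in (dassoc m n r))
    (pair_edge (pair_edge a b) c) x w)).
  have -> : comp_at (sd_in (dassoc m n r)) (pair_edge (pair_edge a b) c) x w =
      mat_assoc (fpro m a) (fpro n b) (fpro r c) x w.
    exact: (at_sidesE (fo_l (sd_in (dassoc m n r)) _)
      (fo_r (sd_in (dassoc m n r)) _)).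
  rewrite -!cmpA (cmp_at3 _ (mat_assocE _ _ _ _ _ _ _)) -!cmpA.
  congr (_ >>> _).
  rewrite (cmp_at3 _ (sum_compE (n := n ⊙ r) a (pair_edge b c) x y w)) -!cmpA.
  rewrite mat_hcmpE !cmpA; congr (_ >>> _).
  rewrite -!tensh_cmp !cmp_idr cmp_idl.
  by rewrite -cmpA sum_compE.
- rewrite -!cmpA.
  rewrite (cmp_at3 _ (sum_compE (m := m ⊙ n) (pair_edge a b) c x z w)) -!cmpA.
  rewrite (cmp_at _ (mat_hcmpE _ _ _ _ _)) -!cmpA.
  have E : (oinj (fpro m a) (fpro n b) x y z ⊠ idm (fpro r c z w)) >>>
      ((sum_inj (m := m ⊙ n) (pair_edge a b) x z ⊠ sum_inj c z w) >>>
       (sum_comp m n (@Total X i x) (@Total Z k z)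
         ⊠ idm (sum_pro r (@Total Z k z) (@Total W l w)))) =
    ((sum_inj a x y ⊠ sum_inj b y z) ⊠ sum_inj c z w) >>>
      (oinj (sum_pro m) (sum_pro n) (@Total X i x) (@Total Y j y) (@Total Z k z)
       ⊠ idm _).
    by rewrite -!tensh_cmp sum_compE cmp_idl.
  rewrite (cmp_at3 _ E) -!cmpA mat_assocE.
  by rewrite (cmp_at _ (massoc_nat _ _ _)) -!cmpA.
Qed.

(** The only summands with content are those on a reflexive edge and an equality
    x = x; on these both sides are the left unitor followed by an injection. *)
Lemma sum_lunit (X Y : fam Mat) (m : pro X Y) p q :
  sum_comp (punit X) m p q >>>
    mat_hcmp_over (@sum_unit X) (fun p q => idm (sum_pro m p q)) p q >>>
    mat_lun (sum_pro m) p q =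
  sum_cell (sd_in (dlunit m)) p q.
Proof.
case: p q => i x [k z]; apply: odot_sum_epi => j a b y.
case: a => i0 e1 e2; destruct e1, e2; rewrite -/(refl_edge i0).
apply: (coprod_epi (is_coprod_tensr (fpro m b y z) (@mat_unitP V _ x y))) => e.
destruct e.
rewrite (sum_cellE (sd_in (dlunit m)) (pair_edge (refl_edge i0) b) x z).
have -> : comp_at (sd_in (dlunit m)) (pair_edge (refl_edge i0) b) x z =
      mat_lun (fpro m b) x z.
  exact: (at_sidesE (fo_l (sd_in (dlunit m)) (pair_edge (refl_edge i0) b))
      (fo_r (sd_in (dlunit m)) (pair_edge (refl_edge i0) b)) x z).
rewrite (cmp_at3 _ (mat_lunE _ _ _)) cmp_idr.
rewrite -!cmpA.
rewrite (cmp_at3 _ (sum_compE (m := punit X) (refl_edge i0) b x x z)) -!cmpA.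
rewrite (cmp_at _ (mat_hcmpE _ _ _ _ _)) -!cmpA.
have E : (mat_unit_inj V (eq_refl x) ⊠ idm (fpro m b x z)) >>>
    ((sum_inj (m := punit X) (refl_edge i0) x x ⊠ sum_inj b x z) >>>
     (sum_unit (@Total X i0 x) (@Total X i0 x) ⊠ idm _)) =
  (idm munit ⊠ sum_inj b x z) >>>
    (mat_unit_inj V (eq_refl (@Total X i0 x)) ⊠ idm _).
  rewrite -!tensh_cmp !cmp_idl cmp_idr.
  by rewrite sum_unit_refl.
rewrite (cmp_at3 _ E) -!cmpA mat_lunE cmp_idr.
exact: mlun_nat.
Qed.

Lemma sum_runit (X Y : fam Mat) (m : pro X Y) p q :
  sum_comp m (punit Y) p q >>>
    mat_hcmp_over (fun p q => idm (sum_pro m p q)) (@sum_unit Y) p q >>>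
    mat_run (sum_pro m) p q =
  sum_cell (sd_in (drunit m)) p q.
Proof.
case: p q => i x [k z]; apply: odot_sum_epi => j a b y.
case: b => j0 e1 e2; destruct e2, e1; rewrite -/(refl_edge j0).
apply: (coprod_epi (is_coprod_tensl (fpro m a x y) (@mat_unitP V _ y z))) => e.
destruct e.
rewrite (sum_cellE (sd_in (drunit m)) (pair_edge a (refl_edge j0)) x y).
have -> : comp_at (sd_in (drunit m)) (pair_edge a (refl_edge j0)) x y =
      mat_run (fpro m a) x y.
  exact: (at_sidesE (fo_l (sd_in (drunit m)) (pair_edge a (refl_edge j0)))
      (fo_r (sd_in (drunit m)) (pair_edge a (refl_edge j0))) x y).
rewrite (cmp_at3 _ (mat_runE _ _ _)) cmp_idr.
rewrite -!cmpA.
rewrite (cmp_at3 _ (sum_compE (n := punit Y) a (refl_edge j0) x y y)) -!cmpA.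
rewrite (cmp_at _ (mat_hcmpE _ _ _ _ _)) -!cmpA.
have E : (idm (fpro m a x y) ⊠ mat_unit_inj V (eq_refl y)) >>>
    ((sum_inj a x y ⊠ sum_inj (m := punit Y) (refl_edge j0) y y) >>>
     (idm _ ⊠ sum_unit (@Total Y j0 y) (@Total Y j0 y))) =
  (sum_inj a x y ⊠ idm munit) >>>
    (idm _ ⊠ mat_unit_inj V (eq_refl (@Total Y j0 y))).
  rewrite -!tensh_cmp !cmp_idl cmp_idr.
  by rewrite sum_unit_refl.
rewrite (cmp_at3 _ E) -!cmpA mat_runE cmp_idr.
exact: mrun_nat.
Qed.

Definition Sum_data : colax_data (fam Mat) Mat :=
  @ColaxData (fam Mat) Mat total sum_hom sum_pro
    (fun X Y W Z m n al => Sided (sum_cell (sd_in al)))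
    (fun X Y Z m n => Sided (sum_comp m n))
    (fun X => Sided (@sum_unit X)).

Lemma Sum_laws : colax_laws Sum_data.
Proof.
split.
- by [].
- by [].
- by [].
- by [].
- by move=> X Y m; apply: mat_over_eq => p q; exact: sum_cell_id.
- by move=> *; apply: mat_over_eq => p q; exact: sum_cell_cmp.
- by [].
- by [].
- move=> X Y Z X' Y' Z' m n m' n' [f g al] [g1 h be] /= e e'.
  destruct e; rewrite (proof_irrelevance _ e' eq_refl).
  by apply: mat_over_eq => p q; exact: sum_comp_nat.
- by move=> X Y f; apply: mat_over_eq => p q; exact: sum_unit_nat.
- move=> X Y Z W m n r e e'.
  rewrite (proof_irrelevance _ e eq_refl) (proof_irrelevance _ e' eq_refl).
  by apply: mat_over_eq => p q; exact: sum_assoc.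
- move=> X Y m e; rewrite (proof_irrelevance _ e eq_refl).
  by apply: mat_over_eq => p q; exact: sum_lunit.
- move=> X Y m e; rewrite (proof_irrelevance _ e eq_refl).
  by apply: mat_over_eq => p q; exact: sum_runit.
Qed.

Definition Sum : colax (fam Mat) Mat := Colax Sum_laws.

Lemma Sum_pseudo : is_pseudo Sum.
Proof.
split.
- by move=> *; apply: mat_cell_invertible; exact: sum_comp_inv.
- by move=> *; apply: mat_cell_invertible; exact: sum_unit_inv.
Qed.

(** * The adjunction with the diagonal *)

Definition eta_ob (X : fam Mat) : hom X (@diag_ob Mat (total X)) :=
  @FamHom Mat X (@diag_ob Mat (total X)) (fun _ => tt)
    (fun i x => @Total X i x).

Definition eta_pro (X Y : fam Mat) (m : pro X Y) :
    cell m (@diag_pro Mat (total X) (total Y) (sum_pro m)) :=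
  let n := @diag_pro Mat (total X) (total Y) (sum_pro m) in
  @Sided _ _ (fam_over m n) (eta_ob X) (eta_ob Y)
    (@FamOver Mat X Y _ _ m n (eta_ob X) (eta_ob Y)
      (fun _ _ _ => edge_one tt tt)
      (fun i j a => @Sided _ _ (mat_over (fpro m a) (sum_pro m))
        (@Total X i) (@Total Y j) (fun x y => sum_inj a x y))
      (fun _ _ _ => eq_refl) (fun _ _ _ => eq_refl)).

Definition eta_data :
    nattr_data (colax_id (fam Mat)) (colax_cmp Sum (diag Mat)) :=
  @NattrData _ _ (colax_id (fam Mat)) (colax_cmp Sum (diag Mat)) eta_ob eta_pro.

Lemma eta_laws : nattr_laws eta_data.
Proof.
split.
- by [].
- by [].
- by move=> X Y f; apply: diag_hom_eq.
- move=> X Y W Z m n [f g al]; apply: const_cell_eq.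
  + by move=> [] [].
  + by apply: diag_hom_eq.
  + by apply: diag_hom_eq.
  + move=> i j a.
    rewrite /= (Sided_at_sides (fo_l al a) (fo_r al a)).
    apply: mat_over_eq => x y; symmetry; exact: sum_cellE.
- move=> X Y Z m n e; rewrite (proof_irrelevance _ e eq_refl).
  apply: (@const_cell_eq Mat _ _ _ _ _ (span_cmp span_one span_one)
    (mat_odot (sum_pro m) (sum_pro n))).
  + by move=> b b'; apply: pullback_eq; exact: unit_eq.
  + by apply: diag_hom_eq.
  + by apply: diag_hom_eq.
  + move=> i k; apply: cmp_edge_ind => j a b.
    apply: mat_over_eq => x z; apply: copair_uniq => y.
    have := sum_compE a b x y z; rewrite -(cmp_idr (sum_comp m n _ _)) => C.
    by rewrite cmp_idl mat_hcmpE; symmetry.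
- move=> X; apply: fam_cell_eq.
  + by apply: diag_hom_eq.
  + by apply: diag_hom_eq.
  + move=> i j [i0 e1 e2]; destruct e1, e2; apply: fc_target_eq.
    apply: mat_over_eq => x y; rewrite cmp_idl; symmetry.
    rewrite (cmpA _ (sum_unit _ _)).
    apply: (eq_trans (cmp_idr _)).
    exact: (sum_copairE (m := punit X) _ (refl_edge i0)).
Qed.

Definition eps_ob (x : Mat) : @hom Mat (total (@diag_ob Mat x)) x :=
  fun p => tval p.

Definition eps_pro (x y : Mat) (m : pro x y) :
    @cell Mat _ _ _ _ (sum_pro (@diag_pro Mat x y m)) m :=
  @Sided _ _ (mat_over (sum_pro (@diag_pro Mat x y m)) m)
    (@eps_ob x) (@eps_ob y)
    (fun p q => sum_copair (m := @diag_pro Mat x y m)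
      (x := tval p) (y := tval q) (fun _ => idm (m (tval p) (tval q)))).

Definition eps_data :
    nattr_data (colax_cmp (diag Mat) Sum) (colax_id Mat) :=
  @NattrData _ _ (colax_cmp (diag Mat) Sum) (colax_id Mat) eps_ob eps_pro.

Lemma eps_laws : nattr_laws eps_data.
Proof.
split.
- by [].
- by [].
- by [].
- move=> x y w z m n [f g al]; apply: mat_over_eq => -[i p] [j q].
  apply: sum_epi => a.
  rewrite (cmp_at _ (sum_cellE _ _ _ _)) -cmpA.
  rewrite (cmp_at _ (sum_copairE (m := @diag_pro Mat x y m) _ a)) cmp_idl.
  rewrite (sum_copairE (m := @diag_pro Mat w z n)).
  exact: cmp_idr.
- move=> x y z m n e; rewrite (proof_irrelevance _ e eq_refl).
  apply: mat_over_eq => -[i p] [k q].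
  apply: sum_epi => a; apply: copair_uniq => t.
  have C : comp_at (sd_in (@diag_comp Mat _ _ _ m n)) a p q =
      idm (mat_odot m n p q).
    exact: (at_sidesE (fo_l (sd_in (@diag_comp Mat _ _ _ m n)) a)
      (fo_r (sd_in (@diag_comp Mat _ _ _ m n)) a) p q).
  (* Folding the two factors of the comparison cell undoes its injections, so
     that both sides reduce to the injection at [t]. *)
  transitivity (oinj m n p t q); last first.
    rewrite (cmp_at _ (sum_copairE (m := @diag_pro Mat _ _ (m ⊙ n)) _ a)).
    by rewrite cmp_idl; symmetry; exact: cmp_idr.
  rewrite -(cmpA (sum_cell _ _ _)).
  rewrite (cmp_at _ (sum_cellE (sd_in (@diag_comp Mat _ _ _ m n)) a p q)) C.
  rewrite cmp_idl.
  rewrite (cmp_at3 _ (sum_compE (m := @diag_pro Mat _ _ m)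
     (n := @diag_pro Mat _ _ n) (edge_one i tt) (edge_one tt k) p t q)).
  rewrite -cmpA mat_hcmpE cmpA -tensh_cmp.
  rewrite (sum_copairE (m := @diag_pro Mat _ _ m)).
  rewrite (sum_copairE (m := @diag_pro Mat _ _ n)) tensh_id; exact: cmp_idl.
- move=> x; apply: mat_over_eq => -[[] p] [[] q].
  apply: sum_epi => a.
  have C : comp_at (sd_in (@diag_unit Mat x)) a p q = idm (mat_unit V p q).
    exact: (at_sidesE (fo_l (sd_in (@diag_unit Mat x)) a)
      (fo_r (sd_in (@diag_unit Mat x)) a) p q).
  transitivity (idm (mat_unit V p q)); last first.
    rewrite (cmp_at _ (sum_copairE (m := @diag_pro Mat _ _ (punit x)) _ a)).
    by rewrite cmp_idl.
  rewrite -(cmpA (sum_cell _ _ _)).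
  rewrite (cmp_at _ (sum_cellE (sd_in (@diag_unit Mat x)) a p q)) C cmp_idl.
  rewrite (cmp_at _ (sum_copairE (m := punit (@diag_ob Mat x)) _
    (refl_edge tt))).
  apply: (coprod_epi (@mat_unitP V x p q)) => e.
  rewrite (cmp_at _ (mat_cunitE V (@Total (@diag_ob Mat x) tt) e)) mat_cunitE.
  by destruct e; rewrite cmp_idr.
Qed.

End Sums.

Theorem proposition4p5 (V : distmon) : has_strong_coproducts (matrices V).
Proof.
exists (Sum V); split; last exact: Sum_pseudo.
apply: inhabits.
apply: (@Adjunction _ _ (Sum V) (diag (matrices V))
  (Nattr (eta_laws V)) (Nattr (eps_laws V))).
- by [].
- move=> X Y m; apply: mat_over_eq => -[i x] [j y].
  apply: sum_epi => a.
  rewrite (cmp_at _ (sum_cellE _ _ _ _)) -cmpA.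
  rewrite (sum_copairE (m := @diag_pro (matrices V) _ _ (sum_pro m))).
  by rewrite !cmp_idr.
- by move=> x; apply: diag_hom_eq.
- move=> x y m; apply: const_cell_eq.
  + by move=> [] [].
  + by apply: diag_hom_eq.
  + by apply: diag_hom_eq.
  + move=> i j a; apply: mat_over_eq => p q.
    exact: (sum_copairE (m := @diag_pro (matrices V) _ _ m)).
Qed.
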